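(* Let $A\subset\mathbb{C}$ be a finite set with $0\notin A$ and $|A|>1$, let $\alpha\in\mathbb{C}$ with $\alpha\ne 0$, and let $\delta=1/4$. Then there are two disjoint subsets $B$ and $C$ of $A$ such that $A=B\sqcup C$ and $$\max\{\mathsf{E}^\times(B),\,\mathsf{E}^\times(\alpha+C)\}\lesssim |A|^{3-\delta}.$$ Further, there are disjoint subsets $B'$ and $C'$ of $A$ such that $A=B'\sqcup C'$ and $$\max\{\mathsf{E}^+(B'),\,\mathsf{E}^+(1/C')\}\lesssim |A|^{3-\delta}.$$
   Context: For a finite set $X\subset\mathbb{C}$, $\mathsf{E}^+(X)$ is the number of $(x_1,x_2,x_3,x_4)\in X^4$ with $x_1+x_3=x_2+x_4$ (additive energy), and $\mathsf{E}^\times(X)$ is the number of $(x_1,x_2,x_3,x_4)\in X^4$ with $x_1x_3=x_2x_4$ (multiplicative energy). $\alpha+C=\{\alpha+c: c\in C\}$ and $1/C'=\{1/c: c\in C'\}$. $U\lesssim V$ means $U\le C_0(\log|A|)^{C_0}V$ for some absolute constant $C_0>0$ (independent of $A$ and $\alpha$). *)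

(* Defs.v *)
From HB Require Import structures.
From mathcomp Require Import all_boot all_order all_algebra finmap complex.
From mathcomp Require Import reals exp.
Set Implicit Arguments.
Unset Strict Implicit.
Unset Printing Implicit Defensive.
Import Order.TTheory GRing.Theory Num.Theory.
Local Open Scope ring_scope.

Definition add_energy (K : nzRingType) (X : {fset K}) : nat :=
  #|[set q : X * X * X * X |
      let: (x1, x2, x3, x4) := q in val x1 + val x3 == val x2 + val x4]|.

Definition mul_energy (K : nzRingType) (X : {fset K}) : nat :=
  #|[set q : X * X * X * X |
      let: (x1, x2, x3, x4) := q in val x1 * val x3 == val x2 * val x4]|.

Definition fset_translate (K : nzRingType) (a : K) (X : {fset K}) : {fset K} :=
  [fset (a + x)%R | x in X]%fset.

Definition fset_inverse (K : unitRingType) (X : {fset K}) : {fset K} :=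
  [fset (x^-1)%R | x in X]%fset.

(* Logarithms are taken to base 2, so that log2 |A| >= 1 as soon as |A| > 1 and
   C0 * (log2 |A|) `^ C0 is nondecreasing in C0; passing to the natural
   logarithm only changes C0 once |A| > 2. *)
Definition log2 (R : realType) (x : R) : R := ln x / ln 2.

(* U <~ V with implied constant C0, where n plays the role of |A|. *)
Definition lesssim (R : realType) (C0 : R) (n : nat) (U V : R) : Prop :=
  U <= C0 * (log2 (n%:R : R)) `^ C0 * V.

Definition is_partition2 (K : choiceType) (A B C : {fset K}) : Prop :=
  A = (B `|` C)%fset /\ [disjoint B & C]%fset.

(* Main.v *)
Require Import Defs.
From HB Require Import structures.
From mathcomp Require Import all_boot all_order all_algebra finmap complex.
From mathcomp Require Import reals exp.
From mathcomp Require Import ring lra zify.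
Set Implicit Arguments.
Unset Strict Implicit.
Unset Printing Implicit Defensive.
Import Order.TTheory GRing.Theory Num.Theory.
Local Open Scope ring_scope.

(** Write N for the size of A.  Both parts are the same statement about two
    quotients g1, g2 on A (v / a and (alpha + v) / (alpha + u), respectively
    v - a and 1/v - 1/u), and the energies are second moments of
    representation functions of g1 and g2.

    The heart is an incidence bound.  For fixed a and u the points
    (g1 a v, g2 u v), v ranging over A, lie on the graph of an affine map or
    of an inversion, hence of a map carrying discs to discs.  Given finite
    sets D and L of values and a scale k, cover D by about k discs holding
    about |D| / k points each and overlapping boundedly often, likewise L
    (cells_exist).  Pulled back to the v-plane these become two families of
    boundedly overlapping discs.  Only O(k) pairs meet, because a disc
    meeting a smaller one contains one of nine test points attached to the
    smaller one (crossing_pairs).  So each curve visits O(k) pairs of cells,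
    and every further point of the curve in D x L shares its cell pair with
    another one.  Two points of D x L lie on at most two curves, so over all
    curves the pairs of points in a common cell number
    O(|D|^2 |L|^2 / k^2).  This gives an elementary Szemeredi-Trotter bound
    for these families of curves (incidence_theorem), and k is free.

    If the g1-energy E of a set X is positive, dyadic pigeonholing yields a
    set D of popular quotients, then a set V of elements of X each having
    many representations by D.  Applied to D and the level sets of the
    g2-representation function of (V, U), the incidence bound controls the
    third moment of that function; by Cauchy-Schwarz the g2-energy of
    (V, U) is at most, up to logarithms, N^(7/2) |V|^2 / E for every subset
    U of A (popular_subset).

    Remove such sets V one after another until the g1-energy of the rest is
    at most M.  The square root of the energy of (C, U) is a norm in the
    representation function, which is additive in C, so the bound, being
    quadratic in |V|, survives disjoint unions: the removed part C has
    g2-energy O(N^(7/2) / M) |C|^2 up to logarithms (decompose).  The choice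
    M = N^(11/4) balances the two energies. *)

(** * Discs in the complex plane *)

Section Discs.
Local Open Scope complex_scope.
Variable R : rcfType.
Implicit Types (z w : R[i]).

Definition sqnorm z : R := complex.Re z ^+ 2 + complex.Im z ^+ 2.
Definition disc (p : R[i]) (r : R) z := sqnorm (z - p) <= r ^+ 2.

Lemma sqnorm_ge0 z : 0 <= sqnorm z.
Proof. by rewrite addr_ge0 ?sqr_ge0. Qed.

Lemma sqnormN z : sqnorm (- z) = sqnorm z.
Proof. by case: z => a b; rewrite /sqnorm /= !sqrrN. Qed.

Lemma sqnormBC z w : sqnorm (z - w) = sqnorm (w - z).
Proof. by rewrite -sqnormN opprB. Qed.

Lemma sqnorm_eq0 z : (sqnorm z == 0) = (z == 0).
Proof.
case: z => a b; rewrite /sqnorm /= eq_complex /=.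
by rewrite paddr_eq0 ?sqr_ge0 // !sqrf_eq0.
Qed.

Lemma sqnormM z w : sqnorm (z * w) = sqnorm z * sqnorm w.
Proof. case: z w => [a b] [c d]; rewrite /sqnorm /=; ring. Qed.

(** The zero vector forms a class of its own. *)
Definition octant (u : R[i]) := (u == 0, 0 <= complex.Re u, 0 <= complex.Im u,
  `|complex.Re u| <= `|complex.Im u|).

(** Two vectors in a common octant make an angle of at most 45 degrees, so the
    longer one is nearer to the shorter one than to the origin. *)
Lemma octant_dist (u v : R[i]) : octant u = octant v -> u != 0 ->
  sqnorm (u - v) < sqnorm u \/ sqnorm (u - v) < sqnorm v.
Proof.
move=> [] e0 e1 e2 e3 u0.
have v0 : v != 0 by rewrite -e0.
have pu : 0 < sqnorm u by rewrite lt0r sqnorm_eq0 u0 sqnorm_ge0.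
have pv : 0 < sqnorm v by rewrite lt0r sqnorm_eq0 v0 sqnorm_ge0.
case: u v {u0 v0 e0} e1 e2 e3 pu pv => [a b] [c d]; rewrite /sqnorm /=.
have abs_sq (x y : R) : (`|x| <= `|y|) = (x ^+ 2 <= y ^+ 2) :> bool.
  by rewrite -[LHS]ler_sqr ?nnegrE ?normr_ge0 // !real_normK ?num_real.
rewrite !abs_sq => e1 e2 e3 pu pv.
have ac : 0 <= a * c by case: (lerP 0 a) e1; case: (lerP 0 c) => //; nra.
have bd : 0 <= b * d by case: (lerP 0 b) e2; case: (lerP 0 d) => //; nra.
(* The angle between the two vectors is at most 45 degrees. *)
have cos45 : (a ^+ 2 + b ^+ 2) * (c ^+ 2 + d ^+ 2) <= 2 * (a * c + b * d) ^+ 2.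
  case: (lerP (a ^+ 2) (b ^+ 2)) e3 => h1; case: (lerP (c ^+ 2) (d ^+ 2)) => h2 // _.
    have h : 0 <= (b ^+ 2 - a ^+ 2) * (d ^+ 2 - c ^+ 2) by apply: mulr_ge0; lra.
    have := mulr_ge0 ac bd; nra.
  have h : 0 <= (a ^+ 2 - b ^+ 2) * (c ^+ 2 - d ^+ 2) by apply: mulr_ge0; lra.
  have := mulr_ge0 ac bd; nra.
case: (ltrP ((a - c) ^+ 2 + (b - d) ^+ 2) (a ^+ 2 + b ^+ 2)) => [|h1]; first by left.
case: (ltrP ((a - c) ^+ 2 + (b - d) ^+ 2) (c ^+ 2 + d ^+ 2)) => [|h2]; first by right.
exfalso; set s := a * c + b * d in cos45.
have s0 : 0 <= s by rewrite addr_ge0.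
set P := a ^+ 2 + b ^+ 2 in cos45 pu h1; set Q := c ^+ 2 + d ^+ 2 in cos45 pv h2.
have hQ : 2 * s <= Q by rewrite /s /Q; rewrite /P in h1; nra.
have hP : 2 * s <= P by rewrite /s /P; rewrite /Q in h2; nra.
have := mulr_gt0 pu pv.
have : (2 * s) * (2 * s) <= P * Q by apply: ler_pM; lra.
nra.
Qed.

Definition overlap_at_most (I : finType) m (S : {set I}) (p : I -> R[i]) (r : I -> R) :=
  forall z, (#|[set i in S | disc (p i) (r i) z]| <= m)%N.

(** Seen from a common point z of two of the discs, the two centres cannot lie
    in the same octant: they would be closer to each other than the larger of
    their distances to z.  There are at most 16 octant classes. *)
Lemma separated_overlap (I : finType) (S : {set I}) (p : I -> R[i]) (r : I -> R) :
  (forall i, i \in S -> 0 < r i) ->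
  (forall i j, i \in S -> j \in S -> i != j -> r i ^+ 2 <= sqnorm (p i - p j)) ->
  overlap_at_most 16 S p r.
Proof.
move=> r_gt0 sep z; pose code i := octant (p i - z).
rewrite -(@card_in_imset _ _ code) => [|i j]; last first.
  rewrite !inE => /andP[iS di] /andP[jS dj] eij; apply/eqP/negPn/negP => nij.
  have dij : p i - z - (p j - z) = p i - p j by ring.
  have di' : sqnorm (p i - z) <= r i ^+ 2 by rewrite sqnormBC.
  have dj' : sqnorm (p j - z) <= r j ^+ 2 by rewrite sqnormBC.
  have si := sep i j iS jS nij; have := sep j i jS iS; rewrite eq_sym => /(_ nij) sj.
  rewrite sqnormBC in sj.
  have [z0|nz] := eqVneq (p i - z) 0.
    have /eqP w0 : p j - z == 0 by case: eij => <- _ _ _; rewrite z0.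
    have pij : p i - p j = 0 by rewrite -dij z0 w0 subr0.
    by move: si; rewrite pij /sqnorm /= expr0n addr0 leNgt exprn_gt0 ?r_gt0.
  have [] := octant_dist eij nz; rewrite dij; first by move=> h; move: (lt_le_trans h di'); rewrite ltNge si.
  by move=> h; move: (lt_le_trans h dj'); rewrite ltNge sj.
by rewrite (leq_trans (max_card _)) // !card_prod !card_bool.
Qed.

(** * Covering a finite set by discs with few points each *)

Section Cells.
Variables (P : finType) (pos : P -> R[i]).
Implicit Types (p q s x y : P) (c : P -> P) (r : P -> R).

(** The partition of D into the fibres of c, the fibre of a centre s lying in
    the disc of radius r s around s. *)
Definition cells (D : {set P}) T (c : P -> P) (r : P -> R) :=
  [/\ forall x, x \in D -> c x \in D /\ disc (pos (c x)) (r (c x)) (pos x),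
      forall s : P, s \in D -> 0 < r s,
      forall s : P, (#|[set x in D | c x == s]| <= T)%N,
      overlap_at_most 16 (c @: D) pos r
    & (#|c @: D| * T <= 16 * #|D| + T)%N].

(** Choose the point with the largest radius, discard what its open disc
    covers, and repeat: a later centre avoids every earlier disc, and the
    earlier discs are the larger ones. *)
Lemma greedy_centers (r : P -> R) (Q : {set P}) :
  (forall x, 0 < r x) ->
  exists c : P -> P,
    [/\ forall x, x \in Q -> c x \in Q /\ sqnorm (pos x - pos (c x)) < r (c x) ^+ 2
      & forall i j, i \in c @: Q -> j \in c @: Q -> i != j ->
          r i ^+ 2 <= sqnorm (pos i - pos j)].
Proof.
move=> r_gt0; have [n] := ubnP #|Q|; elim: n Q => // n IH Q ltQ.
have [->|[p0 p0Q]] := set_0Vmem Q.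
  by exists id; split=> [x|i j]; rewrite ?imset0 inE.
have [p pQ pmax] : exists2 p, p \in Q & forall x, x \in Q -> r x <= r p.
  by case: (@Order.TotalTheory.arg_maxP _ _ _ p0 (mem Q) r p0Q) => p pQ h; exists p.
pose B := [set x | sqnorm (pos x - pos p) < r p ^+ 2].
have pB : p \in B by rewrite inE subrr /sqnorm /= expr0n addr0 exprn_gt0.
have ltQ' : (#|Q :\: B| < n)%N.
  apply: leq_trans (ltQ : (#|Q| <= n)%N); apply: proper_card.
  by apply/properP; split; [exact: subsetDl | exists p => //; rewrite inE pB].
have [c [cQ csep]] := IH _ ltQ'.
pose c' x := if x \in B then p else c x.
have c'E i : i \in c' @: Q -> i = p \/ i \in c @: (Q :\: B).
  case/imsetP=> x xQ ->; rewrite /c'; case: ifPn => xB; first by left.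
  by right; apply/imsetP; exists x; rewrite // inE xB.
have far j : j \in c @: (Q :\: B) ->
    r j ^+ 2 <= sqnorm (pos j - pos p) /\ r p ^+ 2 <= sqnorm (pos p - pos j).
  case/imsetP=> x xQ ->; have [] := cQ x xQ; rewrite !inE -leNgt => /andP[h1 h2] _.
  rewrite (sqnormBC (pos p)); split=> //; apply: le_trans h1.
  by rewrite ler_sqr ?nnegrE ?(ltW (r_gt0 _)) ?pmax.
exists c'; split.
  move=> x xQ; rewrite /c'; case: ifPn => xB; first by split=> //; move: xB; rewrite inE.
  by have [] := cQ x; rewrite inE ?xB // => /andP[_ ->].
move=> i j /c'E[->|iC] /c'E[->|jC]; rewrite ?eqxx // => nij.
- by have [] := far j jC.
- by have [] := far i iC.
- exact: csep.
Qed.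

(** The radius of p is the least one for which the closed disc around p has
    more than T points, so its open disc, where the cell lives, has at most T.
    As the closed discs overlap at most 16 times, there are at most
    16 |D| / T of them.  When |D| <= T no such radius exists and one disc
    suffices, whence the additional T. *)
Lemma cells_exist (D : {set P}) T : (0 < T)%N -> {in D &, injective pos} ->
  exists (c : P -> P) (r : P -> R), cells D T c r.
Proof.
move=> T_gt0 pos_inj.
have [leDT|ltTD] := leqP #|D| T.
  have [->|[p pD]] := set_0Vmem D.
    exists id, (fun=> 1); split=> [x|s|s|z|]; rewrite ?imset0 ?cards0 ?inE //.
    - by rewrite (_ : [set _ in _ | _] = set0) ?cards0 //; apply/setP=> x; rewrite !inE.
    - by rewrite (_ : [set _ in _ | _] = set0) ?cards0 //; apply/setP=> x; rewrite !inE.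
  pose rad := 1 + \sum_x sqnorm (pos x - pos p).
  have sum_ge0 : 0 <= \sum_x sqnorm (pos x - pos p) by apply: sumr_ge0 => *; exact: sqnorm_ge0.
  exists (fun=> p), (fun=> rad); split=> [x xD|s _|s|z|].
  - split=> //; rewrite /disc.
    have : sqnorm (pos x - pos p) <= \sum_x sqnorm (pos x - pos p).
      by rewrite (bigD1 x) //= lerDl sumr_ge0 // => *; exact: sqnorm_ge0.
    by rewrite /rad; nra.
  - by rewrite /rad; lra.
  - by apply: leq_trans leDT; apply: subset_leq_card; apply/subsetP=> x; rewrite inE => /andP[].
  - apply: leq_trans (_ : (#|[set p]| <= 16)%N); last by rewrite cards1.
    by apply/subset_leq_card/subsetP=> x; rewrite !inE => /andP[/imsetP[? _ ->]].
  - have -> : [set p | _ in D] = [set p].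
      by apply/setP=> x; rewrite inE; apply/imsetP/eqP => [[? _ ->]//|->]; exists p.
    by rewrite cards1 mul1n leq_addl.
pose ball p rho := [set x in D | sqnorm (pos x - pos p) <= rho].
pose big p q := (T < #|ball p (sqnorm (pos q - pos p)%R)|)%N.
have ex_far p : exists q, (q \in D) && big p q.
  have [x0 x0D] : exists x0, x0 \in D by apply/card_gt0P; exact: leq_trans ltTD.
  have [q qD qmax] : exists2 q, q \in D & forall x, x \in D -> sqnorm (pos x - pos p) <= sqnorm (pos q - pos p).
    by case: (@Order.TotalTheory.arg_maxP _ _ _ x0 (mem D) (fun x => sqnorm (pos x - pos p)) x0D) => q qD h; exists q.
  exists q; rewrite qD /big; apply: leq_trans ltTD _.
  by apply/subset_leq_card/subsetP=> x xD; rewrite inE xD qmax.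
have nearest p : {q | (q \in D) && big p q & forall x, x \in D -> big p x ->
     sqnorm (pos q - pos p) <= sqnorm (pos x - pos p)}.
  case/sigW: (ex_far p) => q0 q0P.
  case: (@Order.TotalTheory.arg_minP _ _ _ q0 (fun q => (q \in D) && big p q) (fun x => sqnorm (pos x - pos p)) q0P) => q qP h.
  by exists q => // x xD xb; apply: h; rewrite xD.
pose r p := if p \in D then Num.sqrt (sqnorm (pos (s2val (nearest p)) - pos p)) else 1.
have r_sq p : p \in D -> r p ^+ 2 = sqnorm (pos (s2val (nearest p)) - pos p).
  by move=> pD; rewrite /r pD sqr_sqrtr ?sqnorm_ge0.
have r_gt0 p : 0 < r p.
  rewrite /r; case: ifP => // pD; rewrite sqrtr_gt0 lt0r sqnorm_ge0 andbT sqnorm_eq0.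
  case: (nearest p) => q /= /andP[qD qb] _; apply: contraTneq qb => e; rewrite /big e -leqNgt.
  apply: leq_trans (_ : (#|[set p]| <= T)%N); last by rewrite cards1.
  apply/subset_leq_card/subsetP=> x; rewrite !inE => /andP[xD].
  rewrite [sqnorm 0](_ : _ = 0); last by rewrite /sqnorm /= expr0n addr0.
  rewrite le_eqVlt ltNge sqnorm_ge0 orbF sqnorm_eq0 subr_eq0 => /eqP h.
  by rewrite (pos_inj _ _ xD pD h).
have [c [cD csep]] := greedy_centers D r_gt0.
have overlap : overlap_at_most 16 (c @: D) pos r.
  by apply: separated_overlap => // i _; exact: r_gt0.
have imD (s : P) : s \in c @: D -> s \in D by case/imsetP=> x xD ->; have [] := cD x xD.
exists c, r; split=> // [x xD|s|].
- have [h1 h2] := cD x xD; split=> //; exact: ltW.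
- have [sD|sD] := boolP (s \in D); last first.
    rewrite (_ : [set _ in _ | _] = set0) ?cards0 //; apply/setP=> x; rewrite !inE.
    by apply: contraNF sD => /andP[xD /eqP<-]; have [] := cD x xD.
  have [->|[x0 x0C]] := set_0Vmem [set x in D | c x == s]; first by rewrite cards0.
  have [x xC xmax] : exists2 x, x \in [set x in D | c x == s] & forall y, y \in [set x in D | c x == s] -> sqnorm (pos y - pos s) <= sqnorm (pos x - pos s).
    by case: (@Order.TotalTheory.arg_maxP _ _ _ x0 (mem [set x in D | c x == s]) (fun x => sqnorm (pos x - pos s)) x0C) => q qD h; exists q.
  move: (xC); rewrite inE => /andP[xD /eqP cx].
  have small : ~~ big s x.
    apply/negP => bx; have [_] := cD x xD; rewrite cx r_sq //.
    by case: (nearest s) => q /= _ /(_ x xD bx); rewrite leNgt => /negP.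
  rewrite /big -leqNgt in small; apply: leq_trans small.
  apply/subset_leq_card/subsetP=> y yC; rewrite inE xmax // andbT.
  by move: yC; rewrite inE => /andP[].
- have big_disc (s : P) : s \in c @: D -> (T <= #|[set x in D | disc (pos s) (r s) (pos x)]|)%N.
    move/imD => sD; rewrite /disc r_sq //; case: (nearest s) => q /= /andP[_ qb] _.
    exact: ltnW.
  rewrite -sum_nat_const; apply: leq_trans (leq_addr _ _).
  apply: leq_trans (leq_sum _ big_disc) _.
  under eq_bigr do rewrite -sum1dep_card big_mkcondr /=.
  rewrite exchange_big /= mulnC -sum_nat_const; apply: leq_sum => x xD.
  by apply: leq_trans (overlap (pos x)); rewrite -sum1dep_card big_mkcondr.
Qed.

End Cells.

(** * Families of discs pulled back by disc-preserving maps *)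

(** A grid of mesh (4/3) rho around c: every point within 2 rho of c in each
    coordinate is within rho of the grid. *)
Definition test_point (c : R[i]) (rho : R) (m : 'I_3 * 'I_3) : R[i] :=
  c + (rho * (4 / 3) * ((m.1)%:R - 1)) +i* (rho * (4 / 3) * ((m.2)%:R - 1)).

Lemma round_to_grid (rho x : R) : 0 < rho -> x ^+ 2 <= (2 * rho) ^+ 2 ->
  exists i : 'I_3, (rho * (4 / 3) * (i%:R - 1) - x) ^+ 2 <= 4 / 9 * rho ^+ 2.
Proof.
move=> rho0 hx.
have sq_le (a : R) : - (2 / 3 * rho) <= a <= 2 / 3 * rho -> a ^+ 2 <= 4 / 9 * rho ^+ 2.
  by move=> /andP[h1 h2]; nra.
have hx1 : x <= 2 * rho by nra.
have hx2 : - (2 * rho) <= x by nra.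
have [h1|h1] := lerP x (- (2 / 3 * rho)).
  by exists (@Ordinal 3 0 isT); apply: sq_le => /=; apply/andP; split; lra.
have [h2|h2] := lerP x (2 / 3 * rho).
  by exists (@Ordinal 3 1 isT); apply: sq_le => /=; apply/andP; split; lra.
by exists (@Ordinal 3 2 isT); apply: sq_le => /=; apply/andP; split; lra.
Qed.

(** Move from the common point w towards p by the fraction rho / r of the way:
    the disc of radius rho around the point reached lies in the larger disc
    and contains a grid point.  This turns a bound on the overlap of a family
    into a bound on the number of its larger members meeting a given disc. *)
Lemma large_disc_test_point (p c w : R[i]) (r rho : R) :
  0 < rho -> rho <= r -> disc p r w -> disc c rho w ->
  exists m, disc p r (test_point c rho m).
Proof.
move=> rho0 rho_r; case: p c w => [p1 p2] [c1 c2] [w1 w2]; rewrite /disc /sqnorm /= => hp hc.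
have r0 : 0 < r by lra.
have [t [tr t0 t1]] : exists t : R, [/\ t * r = rho, 0 < t & t <= 1].
  exists (rho / r); rewrite divr_gt0 // ler_pdivrMr // mul1r; split=> //.
  by field; lra.
have near (x y : R) : x ^+ 2 <= r ^+ 2 -> y ^+ 2 <= rho ^+ 2 ->
    (y + t * x) ^+ 2 <= (2 * rho) ^+ 2.
  move=> hx hy; have : (t * x) ^+ 2 <= rho ^+ 2.
    by rewrite -tr !exprMn; apply: ler_wpM2l; rewrite ?sqr_ge0.
  nra.
have p1s := sqr_ge0 (w1 - p1); have p2s := sqr_ge0 (w2 - p2).
have c1s := sqr_ge0 (w1 - c1); have c2s := sqr_ge0 (w2 - c2).
have [i hi] : exists i : 'I_3,
    (rho * (4 / 3) * (i%:R - 1) - (w1 - c1 + t * (p1 - w1))) ^+ 2 <= 4 / 9 * rho ^+ 2.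
  by apply: round_to_grid => //; apply: near; [rewrite -sqrrN opprB|]; lra.
have [j hj] : exists j : 'I_3,
    (rho * (4 / 3) * (j%:R - 1) - (w2 - c2 + t * (p2 - w2))) ^+ 2 <= 4 / 9 * rho ^+ 2.
  by apply: round_to_grid => //; apply: near; [rewrite -sqrrN opprB|]; lra.
exists (i, j); rewrite /test_point /=.
move: hi hj; set g1 := _ * (i%:R - 1); set g2 := _ * (j%:R - 1).
(* The point lies within rho of the point of the segment from w to p
   that is at distance at most r - rho from p. *)
have div_t (x : R) : exists e, x = t * e by exists (x / t); field; lra.
have [e1 te1] := div_t (g1 - (w1 - c1 + t * (p1 - w1))).
have [e2 te2] := div_t (g2 - (w2 - c2 + t * (p2 - w2))).
rewrite te1 te2 => hi hj.
have he : e1 ^+ 2 + e2 ^+ 2 <= r ^+ 2.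
  have : t ^+ 2 * (e1 ^+ 2 + e2 ^+ 2) <= t ^+ 2 * r ^+ 2.
    by rewrite -[t ^+ 2 * r ^+ 2]exprMn tr; have := sqr_ge0 rho; nra.
  by rewrite ler_pM2l // exprn_gt0.
have -> : c1 + g1 - p1 = t * e1 + (1 - t) * (w1 - p1) by rewrite -te1; ring.
have -> : c2 + g2 - p2 = t * e2 + (1 - t) * (w2 - p2) by rewrite -te2; ring.
have conv (x y : R) : (t * x + (1 - t) * y) ^+ 2 <= t * x ^+ 2 + (1 - t) * y ^+ 2.
  have : 0 <= t * (1 - t) * (x - y) ^+ 2 by apply: mulr_ge0; [apply: mulr_ge0; lra | exact: sqr_ge0].
  nra.
have := conv e1 (w1 - p1); have := conv e2 (w2 - p2).
have : t * (e1 ^+ 2 + e2 ^+ 2) <= t * r ^+ 2 by apply: ler_wpM2l => //; lra.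
have : (1 - t) * ((w1 - p1) ^+ 2 + (w2 - p2) ^+ 2) <= (1 - t) * r ^+ 2 by apply: ler_wpM2l => //; lra.
nra.
Qed.

(** Preimages of discs are discs, except that a disc containing the value kappa
    of an inversion at infinity has an unbounded preimage.  The point 0 is
    excluded because it is the pole of the inversions considered below, where
    the conventional value of the inverse is not a limit. *)
Definition disc_map (phi : R[i] -> R[i]) := exists kappa ctr rad,
  forall q s, 0 < s -> disc q s kappa \/
    [/\ 0 < rad q s, forall z, disc (ctr q s) (rad q s) z -> disc q s (phi z)
      & forall z, z != 0 -> disc q s (phi z) -> disc (ctr q s) (rad q s) z].

Lemma disc_map_affine (phi : R[i] -> R[i]) b g :
  b != 0 -> (forall z, phi z = b * z + g) -> disc_map phi.
Proof.
move=> b0 phiE; have nb : 0 < sqnorm b by rewrite lt0r sqnorm_eq0 b0 sqnorm_ge0.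
exists 0, (fun q s => (q - g) / b), (fun q s => s / Num.sqrt (sqnorm b)) => q s s0; right.
have eqd z : disc ((q - g) / b) (s / Num.sqrt (sqnorm b)) z = disc q s (phi z).
  rewrite /disc phiE (_ : b * z + g - q = b * (z - (q - g) / b)); last by field.
  rewrite sqnormM exprMn exprVn sqr_sqrtr ?(ltW nb) // -(ler_pM2l nb) mulrCA mulfV ?mulr1 //.
  by rewrite gt_eqF.
by split=> [|z|z _]; rewrite ?eqd // divr_gt0 // sqrtr_gt0.
Qed.

(** For |q - g| > s, the condition |1/z + g - q| <= s is, after multiplying by
    |z|, that of an Apollonius disc. *)
Lemma disc_map_inversion (phi : R[i] -> R[i]) g :
  (forall z, phi z = z^-1 + g) -> disc_map phi.
Proof.
move=> phiE.
pose den q s := sqnorm (q - g) - s ^+ 2.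
pose ctr (q : R[i]) (s : R) : R[i] :=
  (complex.Re (q - g) / den q s) +i* (- complex.Im (q - g) / den q s).
exists g, ctr, (fun q s => s / den q s) => q s s0.
have [|den0] := lerP (sqnorm (q - g)) (s ^+ 2); first by left; rewrite /disc sqnormBC.
have dpos : 0 < den q s by rewrite /den subr_gt0.
have eqd z : z != 0 -> disc (ctr q s) (s / den q s) z = disc q s (phi z).
  move=> z0; have nz : 0 < sqnorm z by rewrite lt0r sqnorm_eq0 z0 sqnorm_ge0.
  rewrite /disc phiE (_ : z^-1 + g - q = (1 - (q - g) * z) / z); last by field.
  rewrite sqnormM (_ : sqnorm z^-1 = (sqnorm z)^-1); last first.
    apply: (mulfI (lt0r_neq0 nz)); rewrite -sqnormM mulfV // mulfV ?lt0r_neq0 //.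
    by rewrite /sqnorm /= expr0n expr1n addr0.
  rewrite ler_pdivrMr //.
  rewrite -(ler_pM2l (exprn_gt0 2 dpos)) [_ * (s / _) ^+ 2](_ : _ = s ^+ 2); last by field; rewrite gt_eqF.
  rewrite -subr_ge0 -[RHS]subr_ge0.
  rewrite -[RHS](pmulr_rge0 _ dpos); congr (0 <= _).
  rewrite /ctr; move: dpos; rewrite /den; case: (q - g) (z) => [a b] [x y].
  rewrite /sqnorm /= => dpos; field.
  by rewrite gt_eqF.
right; split=> [|z dz|z z0]; rewrite ?eqd ?divr_gt0 //.
rewrite -eqd //; apply: contraTneq dz => ->.
rewrite /disc sub0r sqnormN -ltNge /ctr /sqnorm /= !expr_div_n -mulrDl ltr_pM2r ?invr_gt0 ?exprn_gt0 //.
by rewrite sqrrN.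
Qed.

Lemma sum_overlap (I : finType) m (S : {set I}) (p : I -> R[i]) (r : I -> R) z :
  overlap_at_most m S p r -> (\sum_(s in S) (disc (p s) (r s) z : nat) <= m)%N.
Proof.
move=> ov; apply: leq_trans (ov z).
rewrite -sum1dep_card big_mkcondr /=; apply: leq_sum => s _.
by case: (disc _ _ _).
Qed.

(** Each meeting pair is charged to a test point of the smaller preimage, which
    lies in at most 16 preimages of the other family: 9 * 16 pairs per disc.
    The discs around a value at infinity, at most 16 per family, may meet
    everything. *)
Lemma crossing_pairs (T I J : finType) (e : T -> R[i]) (V : {set T})
    (phi psi : R[i] -> R[i]) (S : {set I}) (p : I -> R[i]) (r : I -> R)
    (S' : {set J}) (p' : J -> R[i]) (r' : J -> R) :
  (forall v, v \in V -> e v != 0) ->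
  disc_map phi -> disc_map psi ->
  (forall s, s \in S -> 0 < r s) -> (forall t, t \in S' -> 0 < r' t) ->
  overlap_at_most 16 S p r -> overlap_at_most 16 S' p' r' ->
  (#|[set st : I * J | (st.1 \in S) && ((st.2 \in S') &&
       [exists v in V, disc (p st.1) (r st.1) (phi (e v)) &&
                       disc (p' st.2) (r' st.2) (psi (e v))])]|
     <= 160 * (#|S| + #|S'|))%N.
Proof.
move=> e0 [k [c [h phiP]]] [k' [c' [h' psiP]]] r0 r0' ov ov'.
pose tst s m := psi (test_point (c (p s) (r s)) (h (p s) (r s)) m).
pose tst' t m := phi (test_point (c' (p' t) (r' t)) (h' (p' t) (r' t)) m).
pose a s : nat := disc (p s) (r s) k.
pose b t : nat := disc (p' t) (r' t) k'.
pose f s t : nat := \sum_m (disc (p' t) (r' t) (tst s m) : nat).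
pose g s t : nat := \sum_m (disc (p s) (r s) (tst' t m) : nat).
have one (M : finType) (B : M -> bool) : (exists m, B m) -> (0 < \sum_m (B m : nat))%N.
  by case=> m Bm; rewrite (bigD1 m) //= Bm.
have key s t : s \in S -> t \in S' ->
    ([exists v in V, disc (p s) (r s) (phi (e v)) && disc (p' t) (r' t) (psi (e v))]
       <= a s + b t + f s t + g s t)%N.
  move=> sS tS; case: existsP => //= -[v /andP[vV /andP[dv dv']]].
  have [ks|[hs in_s out_s]] := phiP (p s) (r s) (r0 s sS); first by rewrite /a ks.
  have [kt|[ht in_t out_t]] := psiP (p' t) (r' t) (r0' t tS).
    by rewrite /b kt -!addnA addnCA.
  have {out_s}dv := out_s _ (e0 v vV) dv; have {out_t}dv' := out_t _ (e0 v vV) dv'.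
  have [le_h|/ltW le_h] := lerP (h (p s) (r s)) (h' (p' t) (r' t)).
    have [m dm] := large_disc_test_point hs le_h dv' dv.
    rewrite -addnA addnCA ltn_addr //; apply: one; exists m; exact: in_t.
  have [m dm] := large_disc_test_point ht le_h dv dv'.
  rewrite addnC ltn_addr //; apply: one; exists m; exact: in_s.
have card_test : (144 = #|{: 'I_3 * 'I_3}| * 16)%N by rewrite card_prod !card_ord.
pose meet s t := [exists v in V, disc (p s) (r s) (phi (e v)) && disc (p' t) (r' t) (psi (e v))].
rewrite -sum1dep_card -(pair_big_dep (fun s => s \in S) (fun s t => (t \in S') && meet s t)
  (fun _ _ => 1%N)) /=.
apply: (@leq_trans (\sum_(s in S) \sum_(t in S') (a s + b t + f s t + g s t))%N).
  apply: leq_sum => s sS; rewrite big_mkcondr /=; apply: leq_sum => t tS.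
  by apply: leq_trans (key s t sS tS); rewrite /meet; case: [exists _ in _, _].
under eq_bigr => s sS do rewrite !big_split /=.
rewrite !big_split /=.
have Ha : (\sum_(s in S) \sum_(t in S') a s <= 16 * #|S'|)%N.
  rewrite exchange_big /= mulnC -sum_nat_const; apply: leq_sum => t _.
  exact: sum_overlap.
have Hb : (\sum_(s in S) \sum_(t in S') b t <= 16 * #|S|)%N.
  by rewrite mulnC -sum_nat_const; apply: leq_sum => t _; exact: sum_overlap.
have Hf : (\sum_(s in S) \sum_(t in S') f s t <= 144 * #|S|)%N.
  rewrite mulnC -sum_nat_const; apply: leq_sum => s _; rewrite exchange_big /=.
  rewrite [X in (_ <= X)%N]card_test -sum_nat_const.
  by apply: leq_sum => m _; exact: sum_overlap.
have Hg : (\sum_(s in S) \sum_(t in S') g s t <= 144 * #|S'|)%N.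
  rewrite exchange_big /= mulnC -sum_nat_const; apply: leq_sum => s _; rewrite exchange_big /=.
  rewrite [X in (_ <= X)%N]card_test -sum_nat_const.
  by apply: leq_sum => m _; exact: sum_overlap.
lia.
Qed.

End Discs.

(** * Incidences with graphs of disc-preserving maps *)

(** Every point other than a chosen representative of its fibre forms a pair
    with that representative. *)
Lemma card_le_image_pairs (T Z : finType) (g : T -> Z) (X : {set T}) :
  (#|X| <= #|g @: X| + #|[set p : T * T | [&& p.1 \in X, p.2 \in X, p.1 != p.2 & g p.1 == g p.2]]|)%N.
Proof.
pose h x := odflt x [pick y in X | g y == g x].
have hP x : x \in X -> h x \in X /\ g (h x) = g x.
  move=> xX; rewrite /h; case: pickP => [y /andP[-> /eqP->] //|/(_ x)].
  by rewrite xX eqxx.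
have hE x y : x \in X -> y \in X -> g x = g y -> h x = h y.
  move=> xX yX gxy; rewrite /h (eq_pick (_ : _ =1 [pred z in X | g z == g y])); last first.
    by move=> z /=; rewrite gxy.
  by case: pickP => // /(_ y); rewrite /= yX eqxx.
rewrite -(cardsID [set x | h x == x] X) leq_add //.
  rewrite -(@card_in_imset _ _ g) => [|x y].
    by apply/subset_leq_card/imsetS/subsetIl.
  rewrite !inE => /andP[xX /eqP hx] /andP[yX /eqP hy] gxy.
  by rewrite -hx -hy; exact: hE.
rewrite -(@card_in_imset _ _ (fun x => (x, h x))) => [|x y _ _ []//].
apply/subset_leq_card/subsetP => _ /imsetP[x xX ->].
move: xX; rewrite !inE => /andP[hx xX].
by have [-> ->] := hP x xX; rewrite xX eqxx eq_sym hx.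
Qed.

Lemma card_le_fibers (Z W : finType) (F : Z -> W) (A : {set Z}) (B : {set W}) m :
  (forall z, z \in A -> F z \in B) ->
  (forall w, w \in B -> #|[set z in A | F z == w]| <= m)%N ->
  (#|A| <= #|B| * m)%N.
Proof.
move=> FB fib; rewrite -sum1_card (partition_big F (fun w => w \in B) FB) /=.
rewrite -sum_nat_const; apply: leq_sum => w wB.
by apply: leq_trans (fib w wB); rewrite -sum1dep_card.
Qed.

Definition incidences (T L1 L2 : finType) (f1 : T -> T -> L1) (f2 : T -> T -> L2)
    (V A U : {set T}) (D : {set L1}) (L : {set L2}) : nat :=
  \sum_(a in A) \sum_(u in U) #|[set v in V | (f1 a v \in D) && (f2 u v \in L)]|.

(** The scale k is left free; the choice k^3 ~ (|D| |L|)^2 / (|A| |U|) gives the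
    exponent 2/3 of the Szemeredi-Trotter theorem. *)
Definition incidence_bound (T L1 L2 : finType) (f1 : T -> T -> L1) (f2 : T -> T -> L2) K :=
  forall V A U D L k, (0 < k)%N ->
    (k ^ 2 * incidences f1 f2 V A U D L <=
       K * k ^ 3 * (#|A| * #|U|) + 2 * #|D| ^ 2 * #|L| ^ 2)%N.

Definition same_cell (P : finType) (c : P -> P) (D : {set P}) :=
  [set x : P * P | [&& x.1 \in D, x.2 \in D, x.1 != x.2 & c x.1 == c x.2]].

Lemma card_same_cell (P : finType) (c : P -> P) (D : {set P}) m :
  (forall s, #|[set x in D | c x == s]| <= m.+1)%N -> (#|same_cell c D| <= #|D| * m)%N.
Proof.
move=> cell; apply: (@card_le_fibers _ _ fst) => [x|x xD]; first by rewrite inE => /andP[].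
have h := cell (c x); rewrite (cardsD1 x) inE xD eqxx /= add1n ltnS in h.
apply: leq_trans h; rewrite -(@card_in_imset _ _ snd) => [|[y1 y2] [z1 z2]]; last first.
  by rewrite !inE /= => /andP[_ /eqP->] /andP[_ /eqP->] ->.
apply/subset_leq_card/subsetP=> _ /imsetP[[y1 y2] yP ->].
move: yP; rewrite !inE /= => /andP[/and4P[_ y2D ny cy] /eqP e]; rewrite -{}e y2D eq_sym ny.
by rewrite eq_sym.
Qed.

Section Incidence.
Variable R : rcfType.
Variables (T L1 L2 : finType) (e : T -> R[i]) (pos1 : L1 -> R[i]) (pos2 : L2 -> R[i]).
Variables (f1 : T -> T -> L1) (f2 : T -> T -> L2) (phi psi : T -> R[i] -> R[i]).
Hypotheses (e_neq0 : forall v, e v != 0).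
Hypotheses (pos1_inj : injective pos1) (pos2_inj : injective pos2).
Hypotheses (phi_disc : forall a, disc_map (phi a)) (psi_disc : forall u, disc_map (psi u)).
Hypotheses (phiE : forall a v, pos1 (f1 a v) = phi a (e v)).
Hypotheses (psiE : forall u v, pos2 (f2 u v) = psi u (e v)).
Hypotheses (f1_inj : forall a, injective (f1 a)) (f2_inj : forall u, injective (f2 u)).
Hypothesis two_curves : forall x x' y y', x != x' -> y != y' ->
  (#|[set z : (T * T) * (T * T) | [&& f1 z.1.1 z.2.1 == x, f1 z.1.1 z.2.2 == x',
       f2 z.1.2 z.2.1 == y & f2 z.1.2 z.2.2 == y']]| <= 2)%N.

(** The cells have at most |D| / k + 1 and |L| / k + 1 points, so there are at
    most 17 k cells of either kind, and a curve meets at most 160 * 34 k of the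
    pairs.  A cell with m + 1 points contributes only m partners to each of its
    points, which makes the bound valid for k beyond |D| and |L| too. *)
Lemma incidence_theorem : incidence_bound f1 f2 (160 * 34).
Proof.
move=> V A U D L k k0.
have [c [r [cD r0 cell ov cardS]]] := cells_exist (ltn0Sn (#|D| %/ k)) (in2W pos1_inj : {in D &, _}).
have [c' [r' [cL r0' cell' ov' cardS']]] := cells_exist (ltn0Sn (#|L| %/ k)) (in2W pos2_inj : {in L &, _}).
set S := c @: D in ov cardS; set S' := c' @: L in ov' cardS'.
have SD s : s \in S -> s \in D by case/imsetP=> x xD ->; have [] := cD x xD.
have SL s : s \in S' -> s \in L by case/imsetP=> x xD ->; have [] := cL x xD.
have cells_le n (m : nat) : (m * (n %/ k).+1 <= 16 * n + (n %/ k).+1)%N -> (m <= 17 * k)%N.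
  move=> h; have hn : (n <= k * (n %/ k).+1)%N by rewrite mulnC ltnW // ltn_ceil.
  rewrite -(leq_pmul2r (ltn0Sn (n %/ k))); apply: (leq_trans h); nia.
pose X a u := [set v in V | (f1 a v \in D) && (f2 u v \in L)].
pose g a u v := (c (f1 a v), c' (f2 u v)).
pose Z := [set z : (T * T) * (T * T) |
  ((f1 z.1.1 z.2.1, f1 z.1.1 z.2.2) \in same_cell c D) &&
  ((f2 z.1.2 z.2.1, f2 z.1.2 z.2.2) \in same_cell c' L)].
have curve a u : (#|X a u| <= 160 * 34 * k + \sum_(p : T * T | ((a, u), p) \in Z) 1)%N.
  apply: leq_trans (card_le_image_pairs (g a u) _) _; apply: leq_add.
    apply: (@leq_trans (160 * (#|S| + #|S'|))); last first.
      by have := cells_le _ _ cardS; have := cells_le _ _ cardS'; lia.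
    apply: leq_trans (crossing_pairs (V := V) (e := e) (fun v _ => e_neq0 v) (phi_disc a) (psi_disc u)
      (fun s sS => r0 s (SD s sS)) (fun s sS => r0' s (SL s sS)) ov ov').
    apply/subset_leq_card/subsetP=> _ /imsetP[v vX ->].
    move: vX; rewrite !inE => /and3P[vV xD yL] /=.
    rewrite !imset_f //=; apply/existsP; exists v; rewrite vV -phiE -psiE.
    by have [_ ->] := cD _ xD; have [_ ->] := cL _ yL.
  rewrite sum1dep_card; apply/subset_leq_card/subsetP=> -[v v'].
  rewrite !inE /= => /and4P[/and3P[_ -> ->] /and3P[_ -> ->] nv /eqP[-> ->]].
  by rewrite !eqxx (inj_eq (@f1_inj _)) (inj_eq (@f2_inj _)) nv.
have cardZ : (#|Z| <= #|same_cell c D| * #|same_cell c' L| * 2)%N.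
  rewrite -cardsX.
  apply: (@card_le_fibers _ _ (fun z => ((f1 z.1.1 z.2.1, f1 z.1.1 z.2.2), (f2 z.1.2 z.2.1, f2 z.1.2 z.2.2)))).
    by move=> z; rewrite !inE.
  case=> [[x x'] [y y']]; rewrite !inE /= => /andP[/and4P[_ _ nx _] /and4P[_ _ ny _]].
  apply: leq_trans (two_curves nx ny); apply/subset_leq_card/subsetP=> z.
  by rewrite !inE => /andP[_ /eqP[-> -> -> ->]]; rewrite !eqxx.
have total : (incidences f1 f2 V A U D L <= 160 * 34 * k * (#|A| * #|U|) + #|Z|)%N.
  apply: (@leq_trans (\sum_(a in A) \sum_(u in U) (160 * 34 * k + \sum_(p : T * T | ((a, u), p) \in Z) 1))%N).
    by apply: leq_sum => a _; apply: leq_sum => u _; exact: curve.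
  under eq_bigr do rewrite big_split /= sum_nat_const.
  rewrite big_split /= sum_nat_const mulnA [X in (X + _ <= _)%N]mulnC leq_add2l.
  rewrite -sum1_card pair_big /=.
  rewrite (eq_bigl (fun z : (T * T) * (T * T) => xpredT z.1 && ((z.1, z.2) \in Z))); last by case.
  rewrite -(pair_big_dep xpredT (fun i j => (i, j) \in Z) (fun _ _ => 1%N)) /=.
  rewrite big_mkcond /=; apply: leq_sum => -[a u] _; by case: ifP.
have pD : (k * #|same_cell c D| <= #|D| ^ 2)%N.
  apply: (@leq_trans (k * (#|D| * (#|D| %/ k)))); first by rewrite leq_mul2l card_same_cell ?orbT.
  by rewrite mulnCA -mulnn leq_mul2l mulnC leq_trunc_div orbT.
have pL : (k * #|same_cell c' L| <= #|L| ^ 2)%N.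
  apply: (@leq_trans (k * (#|L| * (#|L| %/ k)))); first by rewrite leq_mul2l card_same_cell ?orbT.
  by rewrite mulnCA -mulnn leq_mul2l mulnC leq_trunc_div orbT.
have := leq_mul pD pL; move: total cardZ; clear; nia.
Qed.

End Incidence.

(** * Energies and popular differences *)

(** The levels 2^j, 0 <= j <= log N, capture g up to a factor 2; one of them
    carries the average share of the moment. *)
Lemma popular_level (I : finType) (g : I -> nat) N p : (0 < p)%N ->
  (forall i, (g i <= N)%N) ->
  exists2 t, (0 < t)%N &
    (\sum_i g i ^ p <= 2 ^ p * (trunc_log 2 N).+1 * (t ^ p * #|[set i | t <= g i]|))%N.
Proof.
move=> p0 gN; set l := trunc_log 2 N.
pose h (j : 'I_l.+1) := ((2 ^ j) ^ p * #|[set i | 2 ^ j <= g i]|)%N.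
have [j0 hmax] : exists j0, forall j, (h j <= h j0)%N.
  by case: (@arg_maxnP _ (ord0 : 'I_l.+1) xpredT h isT) => j0 _ hj; exists j0 => j; exact: hj.
exists (2 ^ j0)%N; first by rewrite expn_gt0.
have dyadic i : (g i ^ p <= \sum_(j < l.+1) 2 ^ p * ((2 ^ j) ^ p * (2 ^ j <= g i)))%N.
  have [->|g0] := posnP (g i); first by rewrite exp0n.
  have /andP[lo hi] := trunc_log_bounds (isT : (1 < 2)%N) g0.
  have jl : (trunc_log 2 (g i) < l.+1)%N by rewrite ltnS leq_trunc_log.
  rewrite (bigD1 (Ordinal jl)) //= lo muln1 -expnMn -expnS.
  by apply: leq_trans (leq_addr _ _); rewrite leq_exp2r // ltnW.
apply: leq_trans (leq_sum _ (fun i _ => dyadic i)) _; rewrite exchange_big /=.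
have -> : (2 ^ p * l.+1 * ((2 ^ j0) ^ p * #|[set i | 2 ^ j0 <= g i]|) = \sum_(j < l.+1) 2 ^ p * h j0)%N.
  by rewrite sum_nat_const card_ord [RHS]mulnCA [RHS]mulnA.
apply: leq_sum => j _; rewrite -big_distrr /= leq_mul2l; apply/orP; right.
apply: leq_trans (hmax j); rewrite -big_distrr /= leq_mul2l; apply/orP; right.
rewrite -sum1dep_card [X in (_ <= X)%N]big_mkcond; apply: leq_sum => i _.
by case: (2 ^ j <= g i)%N.
Qed.

(** Cauchy-Schwarz for g^(1/2) and g^(3/2), obtained by symmetrising the double
    sum so as to stay within the integers. *)
Lemma sum_sq_le_cube (I : finType) (g : I -> nat) :
  ((\sum_i g i ^ 2) ^ 2 <= (\sum_i g i) * \sum_i g i ^ 3)%N.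
Proof.
rewrite -mulnn !big_distrlr /= -(leq_pmul2l (isT : 0 < 2)%N).
have -> : (2 * (\sum_i \sum_j g i * g j ^ 3) = \sum_i \sum_j (g i * g j ^ 3 + g j * g i ^ 3))%N.
  rewrite mul2n -addnn [X in (_ + X)%N]exchange_big -big_split /=.
  by apply: eq_bigr => i _; rewrite big_split.
rewrite big_distrr /=; apply: leq_sum => i _; rewrite big_distrr /=; apply: leq_sum => j _.
have h := nat_Cauchy (g i) (g j); have := leq_mul (leqnn (g i * g j)) h; nia.
Qed.

Definition rep (T L : finType) (f : T -> T -> L) (V U : {set T}) y : nat :=
  #|[set p : T * T | [&& p.1 \in V, p.2 \in U & f p.2 p.1 == y]]|.

Definition energy (T L : finType) (f : T -> T -> L) (V U : {set T}) : nat :=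
  \sum_y rep f V U y ^ 2.

Section Representations.
Variables (T L : finType) (f : T -> T -> L).
Hypotheses (fl_inj : forall u, injective (f u)) (fr_inj : forall v, injective (f ^~ v)).
Implicit Types V U : {set T}.

Lemma rep_le_r V U y : (rep f V U y <= #|U|)%N.
Proof.
rewrite /rep -(@card_in_imset _ _ snd) => [|[v u] [v' u']]; last first.
  rewrite !inE /= => /and3P[_ _ /eqP h] /and3P[_ _ /eqP h'] e; rewrite -{}e in h' *.
  by congr (_, _); apply: (@fl_inj u); rewrite h.
by apply/subset_leq_card/subsetP=> _ /imsetP[p + ->]; rewrite inE => /and3P[].
Qed.

Lemma rep_le_l V U y : (rep f V U y <= #|V|)%N.
Proof.
rewrite /rep -(@card_in_imset _ _ fst) => [|[v u] [v' u']]; last first.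
  rewrite !inE /= => /and3P[_ _ /eqP h] /and3P[_ _ /eqP h'] e; rewrite -{}e in h' *.
  by congr (_, _); apply: (@fr_inj v); rewrite h.
by apply/subset_leq_card/subsetP=> _ /imsetP[p + ->]; rewrite inE => /and3P[].
Qed.

Lemma repE V U y : rep f V U y = (\sum_(v in V) \sum_(u in U) (f u v == y))%N.
Proof.
rewrite /rep -sum1dep_card; under [RHS]eq_bigr do rewrite -big_mkcondr /=.
by rewrite (pair_big_dep _ (fun v u => (u \in U) && (f u v == y))).
Qed.

Lemma sum_rep V U (D : {set L}) :
  (\sum_(y in D) rep f V U y = \sum_(v in V) \sum_(u in U) (f u v \in D))%N.
Proof.
under eq_bigr do rewrite repE.
rewrite exchange_big /=; apply: eq_bigr => v _.
rewrite exchange_big /=; apply: eq_bigr => u _.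
rewrite -big_mkcondr sum1dep_card /=.
have [fD|fD] := boolP (f u v \in D).
  by rewrite (_ : [set _ | _] = [set f u v]) ?cards1 //; apply/setP=> y; rewrite !inE eq_sym andbC; case: eqP => // ->.
by apply/eqP; rewrite cards_eq0; apply/eqP/setP=> y; rewrite !inE andbC; case: eqP => // <-; exact: negbTE.
Qed.

Lemma sum_rep_all V U : (\sum_y rep f V U y = #|V| * #|U|)%N.
Proof.
transitivity (\sum_(y in [set: L]) rep f V U y)%N.
  by apply: eq_bigl => y; rewrite inE.
rewrite sum_rep; under eq_bigr => v _ do under eq_bigr => u _ do rewrite inE.
by rewrite -!sum_nat_const; apply: eq_bigr => v _; rewrite sum1_card.
Qed.

End Representations.

(** * Extracting a subset with small second energy *)

Section Popular.
Variables (T L1 L2 : finType) (f1 : T -> T -> L1) (f2 : T -> T -> L2) (K : nat).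
Hypotheses (K_gt0 : (0 < K)%N) (bound : incidence_bound f1 f2 K).
Hypotheses (f1l_inj : forall a, injective (f1 a)) (f1r_inj : forall v, injective (f1 ^~ v)).
Hypotheses (f2l_inj : forall u, injective (f2 u)) (f2r_inj : forall v, injective (f2 ^~ v)).
Implicit Types (V U A X B C : {set T}) (D : {set L1}) (L : {set L2}).
Local Open Scope nat_scope.

(** Each of the t representations of y in L by (V, U) extends in at least q
    ways by an element a of A. *)
Lemma incidences_ge V A U D L q t :
  (forall v, v \in V -> q <= #|[set a in A | f1 a v \in D]|) ->
  (forall y, y \in L -> t <= rep f2 V U y) ->
  q * (t * #|L|) <= incidences f1 f2 V A U D L.
Proof.
move=> Vq Lt.
have -> : incidences f1 f2 V A U D L =
    \sum_(v in V) \sum_(u in U) #|[set a in A | f1 a v \in D]| * (f2 u v \in L).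
  rewrite /incidences exchange_big [RHS]exchange_big; apply: eq_bigr => u _ /=.
  under eq_bigr do rewrite -sum1dep_card big_mkcondr /=.
  rewrite exchange_big; apply: eq_bigr => v _ /=.
  rewrite -sum1dep_card big_distrl big_mkcondr /=; apply: eq_bigr => a _.
  by case: (f1 a v \in D); case: (f2 u v \in L).
apply: (@leq_trans (q * \sum_(y in L) rep f2 V U y)).
  by rewrite leq_mul2l mulnC -sum_nat_const leq_sum ?orbT.
rewrite sum_rep // big_distrr; apply: leq_sum => v vV; rewrite big_distrr; apply: leq_sum => u _ /=.
by rewrite leq_mul2r Vq ?orbT.
Qed.

(** The least k with 4 d^2 l <= k^2 s makes the second term at most half of the
    left-hand side, so the first term dominates.  For k > 1
    minimality bounds k^2 s by 16 d^2 l; for k = 1 the hypothesis on s^2 takes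
    over. *)
Lemma optimise_scale n d l s :
  0 < s -> s ^ 2 <= d ^ 2 * n ->
  (forall k, 0 < k -> k ^ 2 * (s * l) <= K * k ^ 3 * n + 2 * d ^ 2 * l ^ 2) ->
  s ^ 3 * l <= 64 * K ^ 2 * n ^ 2 * d ^ 2.
Proof.
move=> s0 s_le hk.
have [->|l0] := posnP l; first by rewrite muln0.
have ex : exists k, (0 < k) && (4 * d ^ 2 * l <= k ^ 2 * s).
  by exists (4 * d ^ 2 * l).+1 => /=; nia.
case: (ex_minnP ex) => k /andP[k0 le_k] kmin.
have main : s * l <= 2 * K * n * k.
  have k2 : 0 < k ^ 2 by rewrite expn_gt0 k0.
  have := hk k k0; have := leq_mul (leqnn l) le_k => h1 h2.
  rewrite -(leq_pmul2l k2).
  have -> : k ^ 2 * (2 * K * n * k) = 2 * (K * k ^ 3 * n) by rewrite (expnS k 2); lia.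
  nia.
have [k1|k1] := leqP k 1.
  have e : k = 1 by apply/eqP; rewrite eqn_leq k1.
  rewrite {}e muln1 in main.
  have := leq_mul s_le main.
  have -> : s ^ 2 * (s * l) = s ^ 3 * l by rewrite (expnS s 2); lia.
  move=> h; apply: leq_trans h _.
  have -> : d ^ 2 * n * (2 * K * n) = 2 * K * (n ^ 2 * d ^ 2) by rewrite -[n ^ 2]mulnn; lia.
  by rewrite -[64 * _ * _ * _]mulnA leq_mul2r; apply/orP; right; nia.
have k2s : k ^ 2 * s <= 16 * (d ^ 2 * l).
  have : ~~ (4 * d ^ 2 * l <= k.-1 ^ 2 * s).
    apply/negP=> h; have /kmin : (0 < k.-1) && (4 * d ^ 2 * l <= k.-1 ^ 2 * s) by rewrite h andbT; lia.
    lia.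
  rewrite -ltnNge => h.
  have : k ^ 2 <= 4 * k.-1 ^ 2 by nia.
  move/(leq_mul (leqnn s)); nia.
rewrite -(leq_pmul2r l0).
have -> : s ^ 3 * l * l = (s * l) ^ 2 * s by rewrite (expnS s 2) expnMn -!mulnn; lia.
apply: (@leq_trans ((2 * K * n * k) ^ 2 * s)); first by rewrite leq_mul2r leq_exp2r // main orbT.
have -> : (2 * K * n * k) ^ 2 * s = 4 * (K ^ 2 * n ^ 2) * (k ^ 2 * s) by rewrite !expnMn; lia.
have -> : 64 * K ^ 2 * n ^ 2 * d ^ 2 * l = 4 * (K ^ 2 * n ^ 2) * (16 * (d ^ 2 * l)) by lia.
by rewrite leq_mul2l k2s orbT.
Qed.

(** The size condition of the optimisation holds as soon as the level set is
    nonempty: q <= |D| because a is determined by v and f1 a v, and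
    t^2 <= |V| |U|. *)
Lemma rich_bound V A U D q t :
  (forall v, v \in V -> q <= #|[set a in A | f1 a v \in D]|) -> 0 < q -> 0 < t ->
  (q * t) ^ 3 * #|[set y | t <= rep f2 V U y]| <= 64 * K ^ 2 * (#|T| * #|U|) ^ 2 * #|D| ^ 2.
Proof.
move=> Vq q0 t0; set L := [set y | _].
have [->|[y yL]] := set_0Vmem L; first by rewrite cards0 muln0.
have LtE y' : y' \in L -> t <= rep f2 V U y' by rewrite inE.
apply: optimise_scale.
- by rewrite muln_gt0 q0.
- rewrite expnMn; have ty := LtE y yL.
  have tU := leq_trans ty (rep_le_r f2l_inj V U y).
  have tV := leq_trans ty (rep_le_l f2r_inj V U y).
  have [v vV] : exists v, v \in V by apply/card_gt0P; exact: leq_trans tV.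
  apply: leq_mul.
    rewrite leq_exp2r //; apply: leq_trans (Vq v vV) _.
    rewrite -(card_imset _ (@f1r_inj v)); apply/subset_leq_card/subsetP=> _ /imsetP[a + ->].
    by rewrite inE => /andP[].
  by rewrite -mulnn leq_mul // (leq_trans tV) // max_card.
move=> k k0; apply: (@leq_trans (k ^ 2 * incidences f1 f2 V A U D L)).
  by rewrite leq_mul2l -mulnA incidences_ge ?orbT.
apply: leq_trans (bound _ _ _ _ _ k0) _; rewrite leq_add2r leq_mul2l leq_mul2r max_card !orbT //.
Qed.

Let ell := (trunc_log 2 #|T|).+1.

(** The level sets control the third moment of the representation function, up
    to a logarithm; its first moment is |V| |U|. *)
Lemma energy_le_popular V A U D q :
  (forall v, v \in V -> q <= #|[set a in A | f1 a v \in D]|) -> 0 < q ->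
  energy f2 V U ^ 2 * q ^ 3 <=
    512 * ell * K ^ 2 * #|T| ^ 2 * #|V| * #|U| ^ 3 * #|D| ^ 2.
Proof.
move=> Vq q0.
have [t t0 ht] := @popular_level _ (rep f2 V U) #|T| 3 isT
   (fun y => leq_trans (rep_le_r f2l_inj V U y) (max_card _)).
have h := rich_bound U Vq q0 t0.
have := sum_sq_le_cube (rep f2 V U); rewrite sum_rep_all -/(energy f2 V U) => CS.
apply: leq_trans (leq_mul CS (leqnn (q ^ 3))) _; rewrite -mulnA.
apply: (@leq_trans (#|V| * #|U| * (8 * ell * (64 * K ^ 2 * (#|T| * #|U|) ^ 2 * #|D| ^ 2)))).
  rewrite leq_mul2l; apply/orP; right.
  apply: leq_trans (leq_mul ht (leqnn _)) _; rewrite -mulnA -/ell leq_mul2l; apply/orP; right.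
  by apply: leq_trans h; rewrite expnMn; lia.
by rewrite !expnMn (expnS #|U| 2); lia.
Qed.

(** With d popular quotients of multiplicity tau and q representations for each
    v in V, pigeonholing gives E ~ d tau^2 and q |V| ~ d tau.  Inserting
    q^3 ~ (d tau / |V|)^3 into the previous bound leaves 1 / (d tau^3), which is
    d tau / E^2 and at most n^2 / E^2. *)
Lemma popular_subset X : 0 < energy f1 X X ->
  exists V, [/\ V \subset X, V != set0 & forall U,
    energy f2 V U ^ 2 * energy f1 X X ^ 2 <= 256 ^ 2 * K ^ 2 * ell ^ 6 * #|T| ^ 7 * #|V| ^ 4].
Proof.
set E := energy f1 X X => E0; set n := #|T|.
have Xn : #|X| <= n by exact: max_card.
have [tau tau0 htau] := @popular_level _ (rep f1 X X) n 2 isT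
   (fun y => leq_trans (rep_le_r f1l_inj X X y) (max_card _)).
rewrite -/(energy f1 X X) -/E -/ell in htau; set D := [set y | _] in htau; set d := #|D| in htau.
pose w v := if v \in X then #|[set a in X | f1 a v \in D]| else 0.
have wn v : w v <= n by rewrite /w; case: ifP => // _; exact: max_card.
have [q q0 hq] := @popular_level _ w n 1 isT wn.
rewrite !expn1 -/ell in hq; set V := [set v | _] in hq.
have VX : V \subset X.
  by apply/subsetP=> v; rewrite inE /w; case: ifP => //; rewrite leqNgt q0.
have sumw : \sum_v w v ^ 1 = \sum_(y in D) rep f1 X X y.
  rewrite sum_rep // [RHS]big_mkcond /=; apply: eq_bigr => v _; rewrite expn1 /w.
  case: ifP => // _; rewrite -sum1dep_card big_mkcondr /=; apply: eq_bigr => a _.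
  by case: (_ \in _).
have hd : d * tau <= \sum_(y in D) rep f1 X X y.
  by rewrite -sum_nat_const; apply: leq_sum => y; rewrite inE.
have hN : d * tau <= n ^ 2.
  apply: leq_trans hd _; apply: (@leq_trans (\sum_y rep f1 X X y)).
    by rewrite [X in X <= _]big_mkcond; apply: leq_sum => y _; case: ifP.
  by rewrite sum_rep_all -mulnn leq_mul.
have dt0 : 0 < d * tau.
  rewrite muln_gt0 tau0 andbT lt0n; apply: contraL E0 => /eqP d0.
  by move: htau; rewrite d0 muln0 muln0 leqn0 => /eqP->.
have hV : d * tau <= 2 * ell * (q * #|V|) by apply: (leq_trans hd); rewrite -sumw.
exists V; split=> //.
  by apply: contraTneq dt0 => V0; move: hV; rewrite V0 cards0 !muln0; lia.
move=> U; have Un : #|U| <= n by exact: max_card.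
have Vq v : v \in V -> q <= #|[set a in X | f1 a v \in D]|.
  by rewrite inE /w; case: ifP => // _; rewrite leqNgt q0.
have h := energy_le_popular U Vq q0; rewrite -/n -/d in h.
set F := energy f2 V U in h *; set v := #|V| in h hV *; set u := #|U| in h Un.
have d0 : 0 < d ^ 2 by move: dt0; rewrite expn_gt0 muln_gt0 => /andP[->].
have step1 : F ^ 2 * (d * tau) ^ 3 <= 8 * ell ^ 3 * v ^ 3 * (512 * ell * K ^ 2 * n ^ 2 * v * u ^ 3 * d ^ 2).
  apply: (@leq_trans (8 * ell ^ 3 * v ^ 3 * (F ^ 2 * q ^ 3))); last by rewrite leq_mul2l h orbT.
  have -> : 8 * ell ^ 3 * v ^ 3 * (F ^ 2 * q ^ 3) = F ^ 2 * (2 * ell * (q * v)) ^ 3.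
    by rewrite !expnMn; lia.
  by rewrite leq_mul2l leq_exp2r // hV orbT.
have step2 : E ^ 2 <= 16 * ell ^ 2 * (tau ^ 4 * d ^ 2).
  have -> : 16 * ell ^ 2 * (tau ^ 4 * d ^ 2) = (2 ^ 2 * ell * (tau ^ 2 * d)) ^ 2.
    by lia.
  by rewrite leq_exp2r.
rewrite -(leq_pmul2r d0).
apply: (@leq_trans (16 * ell ^ 2 * (d * tau) * (F ^ 2 * (d * tau) ^ 3))).
  have -> : 16 * ell ^ 2 * (d * tau) * (F ^ 2 * (d * tau) ^ 3) = F ^ 2 * (16 * ell ^ 2 * (tau ^ 4 * d ^ 2)) * d ^ 2.
    by rewrite expnMn (expnS tau 3) (expnS d 2); lia.
  by rewrite leq_mul2r leq_mul2l step2 !orbT.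
apply: (@leq_trans (16 * ell ^ 2 * n ^ 2 * (8 * ell ^ 3 * v ^ 3 * (512 * ell * K ^ 2 * n ^ 2 * v * n ^ 3 * d ^ 2)))).
  apply: leq_mul; first by rewrite leq_mul2l hN orbT.
  apply: leq_trans step1 _; rewrite !leq_mul2l !leq_mul2r leq_mul2l leq_exp2r // Un !orbT //.
apply: eq_leq.
have -> : ell ^ 6 = ell ^ 2 * ell ^ 3 * ell by rewrite -expnD -expnSr.
have -> : n ^ 7 = n ^ 2 * n ^ 2 * n ^ 3 by rewrite -!expnD.
rewrite (expnSr v 3); set a := ell ^ 2; set b := ell ^ 3; set x := n ^ 2; set y := n ^ 3; set z := v ^ 3.
set k := K ^ 2; set m := d ^ 2; clear; lia.
Qed.

Lemma rep_disjointU V C U y : [disjoint V & C] ->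
  rep f2 (V :|: C) U y = rep f2 V U y + rep f2 C U y.
Proof.
move=> dVC; rewrite !repE -bigU //; apply: eq_bigl => v.
by rewrite in_setU.
Qed.

Lemma energy_set0 (L : finType) (f : T -> T -> L) U : energy f set0 U = 0.
Proof. by rewrite /energy big1 // => y _; rewrite repE big_set0. Qed.

(** Minkowski's inequality for the two representation functions, squared with
    the weights |V| and |C|. *)
Lemma energy_disjointU V C U : [disjoint V & C] ->
  #|V| * #|C| * energy f2 (V :|: C) U <=
    (#|V| + #|C|) * (#|C| * energy f2 V U + #|V| * energy f2 C U).
Proof.
move=> dVC; rewrite /energy !big_distrr -big_split big_distrr /=.
apply: leq_sum => y _; rewrite rep_disjointU //.
set x := rep _ V _ _; set z := rep _ C _ _; set v := #|V|; set c := #|C|.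
have [h _] := nat_Cauchy (c * x) (v * z); nia.
Qed.

Local Close Scope nat_scope.

(** The bound on the energy of (C, U) is stated for all U: only then does it add
    up along the induction, in which C grows. *)
Lemma decompose (R : realFieldType) (kappa M : R) : 0 < M -> 0 <= kappa ->
  (256 ^ 2 * K ^ 2 * ell ^ 6 * #|T| ^ 7)%N%:R <= (kappa * M) ^+ 2 ->
  forall X, exists B C, [/\ B :|: C = X, [disjoint B & C], (energy f1 B B)%:R <= M
     & forall U, (energy f2 C U)%:R <= kappa * #|C|%:R ^+ 2].
Proof.
move=> M0 k0 kM X; have [m] := ubnP #|X|; elim: m X => // m IH X ltX.
have [leM|ltM] := lerP (energy f1 X X)%:R M.
  exists X, set0; split=> //; first by rewrite setU0.
    by rewrite -setI_eq0 setI0.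
  by move=> U; rewrite energy_set0 cards0 expr0n mulr0.
have E0 : (0 < energy f1 X X)%N by rewrite -(ltr0n R); exact: lt_trans ltM.
have [V [VX Vn0 hV]] := popular_subset E0.
have v0 : (0 < #|V|)%N by rewrite card_gt0.
have [|B [C [BC dBC EB EC]]] := IH (X :\: V).
  apply: leq_trans (ltX : (#|X| <= m)%N); rewrite -[in X in (_ < X)%N](cardsID V X).
  by rewrite (setIidPr VX) -[X in (X < _)%N]add0n ltn_add2r.
have dVC : [disjoint V & C].
  rewrite -setI_eq0; apply/eqP/setP=> x; rewrite !inE; apply/negP=> /andP[xV xC].
  by have := in_setU x B C; rewrite BC xC orbT inE xV.
have dVB : [disjoint V & B].
  rewrite -setI_eq0; apply/eqP/setP=> x; rewrite !inE; apply/negP=> /andP[xV xB].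
  by have := in_setU x B C; rewrite BC xB inE xV.
exists B, (V :|: C); split=> //.
- by rewrite setUCA BC -{2}(setID X V) (setIidPr VX).
- by rewrite -setI_eq0 setIUr setU_eq0 !setI_eq0 dBC disjoint_sym dVB.
have EV U : (energy f2 V U)%:R <= kappa * #|V|%:R ^+ 2.
  rewrite -ler_sqr ?nnegrE ?mulr_ge0 ?exprn_ge0 ?ler0n // -(ler_pM2r (exprn_gt0 2 M0)).
  apply: (@le_trans _ _ ((energy f2 V U ^ 2 * energy f1 X X ^ 2)%N%:R)).
    by rewrite natrM !natrX ler_wpM2l ?sqr_ge0 // ler_sqr ?nnegrE ?ler0n // ltW.
  apply: (@le_trans _ _ (256 ^ 2 * K ^ 2 * ell ^ 6 * #|T| ^ 7 * #|V| ^ 4)%N%:R).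
    by rewrite ler_nat.
  rewrite natrM -exprMn mulrAC exprMn -exprM natrX.
  by apply: ler_wpM2r kM; rewrite exprn_ge0.
move=> U; have [C0|[x xC]] := set_0Vmem C; first by rewrite C0 setU0; exact: EV.
have c0 : (0 < #|C|)%N by apply/card_gt0P; exists x.
have vc0 : 0 < #|V|%:R * #|C|%:R :> R by rewrite mulr_gt0 ?ltr0n.
rewrite -(ler_pM2l vc0) cardsU disjoint_setI0 // cards0 subn0.
have := energy_disjointU U dVC; rewrite -(ler_nat R) !(natrM, natrD) => h.
apply: le_trans h _; rewrite ?(natrM, natrD).
set v := #|V|%:R in vc0 *; set c := #|C|%:R in vc0 *.
have -> : v * c * (kappa * (v + c) ^+ 2) = (v + c) * (c * (kappa * v ^+ 2) + v * (kappa * c ^+ 2)) by ring.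
apply: ler_wpM2l; first by rewrite addr_ge0 ?ler0n.
by apply: lerD; apply: ler_wpM2l; rewrite ?ler0n ?EV ?EC.
Qed.

End Popular.

(** * From energies on a finite type to energies of sets of complex numbers *)

(** Transfer of counts of quadruples along a partial injection from Y to T, given
    by the positions e and d in a common type Z and defined on G. *)
Lemma card_quadruples_le (Y T : finType) (Z : eqType) (e : Y -> Z) (d : T -> Z)
    (G : {set Y}) (P : pred (Y * Y * Y * Y)) (Q : pred (T * T * T * T)) :
  {in G &, injective e} -> (forall y, y \in G -> exists t, d t = e y) ->
  (forall x1 x2 x3 x4, P (x1, x2, x3, x4) -> [&& x1 \in G, x2 \in G, x3 \in G & x4 \in G]) ->
  (forall x1 x2 x3 x4 t1 t2 t3 t4, P (x1, x2, x3, x4) ->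
     d t1 = e x1 -> d t2 = e x2 -> d t3 = e x3 -> d t4 = e x4 -> Q (t1, t2, t3, t4)) ->
  (#|[set q | P q]| <= #|[set q | Q q]|)%N.
Proof.
move=> e_inj ex PG PQ.
have [->|[[[[x1 x2] x3] x4] qP]] := set_0Vmem [set q | P q]; first by rewrite cards0.
have [t0 _] : exists t, d t = e x1.
  by apply: ex; move: qP; rewrite inE => /PG /andP[].
pose h y := odflt t0 [pick t | d t == e y].
have hP y : y \in G -> d (h y) = e y.
  move=> yG; rewrite /h; case: pickP => [t /eqP //|no].
  by have [t dt] := ex y yG; have := no t; rewrite dt eqxx.
have h_inj y y' : y \in G -> y' \in G -> h y = h y' -> y = y'.
  by move=> yG yG' hh; apply: e_inj; rewrite -?hP ?hh.
pose H (q : Y * Y * Y * Y) := let: (y1, y2, y3, y4) := q in (h y1, h y2, h y3, h y4).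
rewrite -(@card_in_imset _ _ H) => [|[[[y1 y2] y3] y4] [[[z1 z2] z3] z4]]; last first.
  rewrite !inE => /PG /and4P[? ? ? ?] /PG /and4P[? ? ? ?] [? ? ? ?].
  by congr (_, _, _, _); apply: h_inj.
apply/subset_leq_card/subsetP=> _ /imsetP[[[[y1 y2] y3] y4] yP ->].
rewrite !inE in yP *; have /and4P[? ? ? ?] := PG _ _ _ _ yP.
by apply: PQ yP _ _ _ _; rewrite hP.
Qed.

Lemma card_quadruples_le_energy (T L : finType) (f : T -> T -> L) (V : {set T}) :
  (#|[set q : T * T * T * T | let: (v, a, b, w) := q in
       [&& v \in V, a \in V, b \in V, w \in V & f a v == f b w]]| <= energy f V V)%N.
Proof.
rewrite -sum1_card (partition_big (fun q => f q.1.1.2 q.1.1.1) predT) //=.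
apply: leq_sum => y _; rewrite sum1dep_card -mulnn -cardsX.
rewrite -(@card_in_imset _ _ (fun q => ((q.1.1.1, q.1.1.2), (q.2, q.1.2)))) => [|]; last first.
  by move=> [[[? ?] ?] ?] [[[? ?] ?] ?] _ _ [-> -> -> ->].
apply/subset_leq_card/subsetP=> _ /imsetP[[[[v a] b] w] qP ->].
move: qP; rewrite !inE /= => /andP[/and5P[-> -> -> -> /eqP <-] ->].
by [].
Qed.

(** For g a z = z - a and g a z = z / a this is the additive and the
    multiplicative energy: x1 + x3 = x2 + x4 is x1 - x2 = x4 - x3. *)
Definition quotient_energy (K : choiceType) (g : K -> K -> K) (X : {fset K}) : nat :=
  #|[set q : X * X * X * X |
      let: (x1, x2, x3, x4) := q in g (val x2) (val x1) == g (val x3) (val x4)]|.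

Section FsetDecomposition.
Variables (R : rcfType) (S : {fset R[i]}) (phi psi : R[i] -> R[i] -> R[i]).

(** The existence of w1 and w2 says that two points of the plane lie on at most
    two curves: v then takes at most two values, and v determines a, u and v'. *)
Lemma decompose_fset (kappa M : R) :
  0 \notin S ->
  {in S, forall a, disc_map (phi a)} -> {in S, forall u, disc_map (psi u)} ->
  {in S, forall a, {in S &, injective (phi a)}} ->
  {in S, forall v, {in S &, injective (phi ^~ v)}} ->
  {in S, forall u, {in S &, injective (psi u)}} ->
  {in S, forall v, {in S &, injective (psi ^~ v)}} ->
  (forall x x' y y', x != x' -> y != y' -> exists w1 w2, forall a u v v',
     a \in S -> u \in S -> v \in S -> v' \in S ->
     phi a v = x -> phi a v' = x' -> psi u v = y -> psi u v' = y' -> v = w1 \/ v = w2) ->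
  0 < M -> 0 <= kappa ->
  (256 ^ 2 * (160 * 34) ^ 2 * (trunc_log 2 #|` S|).+1 ^ 6 * #|` S| ^ 7)%N%:R <= (kappa * M) ^+ 2 ->
  exists B C, [/\ is_partition2 S B C, (quotient_energy phi B)%:R <= M
     & (quotient_energy psi C)%:R <= kappa * #|` S|%:R ^+ 2].
Proof.
move=> S0 phid psid phil phir psil psir two M0 k0 kM.
pose F1 (p : S * S) := phi (val p.1) (val p.2).
pose F2 (p : S * S) := psi (val p.1) (val p.2).
pose f1 (a v : S) : seq_sub (codom F1) := SeqSub (codom_f F1 (a, v)).
pose f2 (u v : S) : seq_sub (codom F2) := SeqSub (codom_f F2 (u, v)).
have f1l a : injective (f1 a) by move=> v v' [] /phil e; apply: val_inj; apply: e; exact: valP.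
have f1r v : injective (f1 ^~ v) by move=> a a' [] /phir e; apply: val_inj; apply: e; exact: valP.
have f2l a : injective (f2 a) by move=> v v' [] /psil e; apply: val_inj; apply: e; exact: valP.
have f2r v : injective (f2 ^~ v) by move=> a a' [] /psir e; apply: val_inj; apply: e; exact: valP.
have bound : incidence_bound f1 f2 (160 * 34).
  apply: (@incidence_theorem R _ _ _ (fun v : S => val v) (fun x => ssval x) (fun x => ssval x)
     _ _ (fun a => phi (val a)) (fun u => psi (val u))) => //.
  - by move=> v; apply: contraNneq S0 => <-; exact: valP.
  - exact: val_inj.
  - exact: val_inj.
  - by move=> a; apply: phid; exact: valP.
  - by move=> a; apply: psid; exact: valP.
  move=> x x' y y' nx ny; have [w1 [w2 hw]] := two (ssval x) (ssval x') (ssval y) (ssval y') nx ny.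
  have at_most_one (w : R[i]) : (#|[set v : S | val v == w]| <= 1)%N.
    apply/card_le1_eqP=> v v'; rewrite !inE => /eqP h /eqP h'.
    by apply: val_inj; rewrite /= h h'.
  rewrite -(@card_in_imset _ _ (fun z => z.2.1)) => [|[[a u] [v v']] [[b t] [z z']]]; last first.
    rewrite !inE /= => /and4P[/eqP ex /eqP ex' /eqP ey /eqP ey'] /and4P[/eqP hx /eqP hx' /eqP hy /eqP hy'] evz.
    subst z; have eab : a = b by apply: (@f1r v); rewrite ex hx.
    subst b; have eut : u = t by apply: (@f2r v); rewrite ey hy.
    by subst t; congr (_, (_, _)); apply: (@f1l a); rewrite ex' hx'.
  apply: (@leq_trans #|[set v : S | val v == w1] :|: [set v : S | val v == w2]|).
    apply/subset_leq_card/subsetP=> _ /imsetP[[[a u] [v v']] zP ->].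
    move: zP; rewrite !inE /= => /and4P[/eqP ex /eqP ex' /eqP ey /eqP ey'].
    have [||||->|->] := hw (val a) (val u) (val v) (val v') (valP a) (valP u) (valP v) (valP v').
    - by rewrite -ex.
    - by rewrite -ex'.
    - by rewrite -ey.
    - by rewrite -ey'.
    - by rewrite eqxx.
    - by rewrite eqxx orbT.
  by apply: leq_trans (leq_card_setU _ _) _; apply: (leq_add (at_most_one w1) (at_most_one w2)).
have cardS : #|{: S}| = #|` S| by rewrite -cardfE.
rewrite -cardS in kM *.
have [B [C [BC dBC EB EC]]] := decompose (isT : (0 < 160 * 34)%N) bound f1l f1r f2l f2r M0 k0 kM [set: S].
have quot_le (L : finType) (f : S -> S -> L) (g : R[i] -> R[i] -> R[i]) (X : {set S}) :
    (forall a v b w, g (val a) (val v) = g (val b) (val w) -> f a v = f b w) ->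
    (quotient_energy g [fset val x | x in X]%fset <= energy f X X)%N.
  move=> gf; apply: leq_trans (card_quadruples_le_energy f X).
  apply: (@card_quadruples_le _ _ R[i] val val setT).
  - by move=> x y _ _; exact: val_inj.
  - by move=> y _; have /imfsetP[x _ yx] := valP y; exists x.
  - by move=> *; rewrite !inE.
  move=> x1 x2 x3 x4 t1 t2 t3 t4 /eqP h e1 e2 e3 e4.
  have inX (t : S) (x : [fset val x | x in X]%fset) : val t = val x -> t \in X.
    by move=> tx; have /imfsetP[z zX xz] := valP x; rewrite (_ : t = z) //; apply: val_inj; rewrite tx.
  rewrite (inX _ _ e1) (inX _ _ e2) (inX _ _ e3) (inX _ _ e4) /=; apply/eqP; apply: gf.
  by rewrite e1 e2 e3 e4.
exists [fset val x | x in B]%fset, [fset val x | x in C]%fset; split.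
- split.
    apply/fsetP=> z; rewrite inE; apply/idP/orP => [zS|[]/imfsetP[x _ ->]]; try exact: valP.
    have : [` zS]%fset \in B :|: C by rewrite BC inE.
    by rewrite inE => /orP[] h; [left|right]; apply/imfsetP; exists [` zS]%fset.
  apply/fdisjointP=> z /imfsetP[x /= xB ->]; apply/imfsetP=> -[y /= yC /val_inj exy].
  by have := disjointFr dBC xB; rewrite exy yC.
- apply: le_trans EB; rewrite ler_nat; apply: quot_le => a v b w e.
  by apply: val_inj.
apply: le_trans (_ : kappa * #|C|%:R ^+ 2 <= _); last first.
  by rewrite ler_wpM2l // ler_sqr ?nnegrE // ler_nat max_card.
apply: le_trans (EC C); rewrite ler_nat; apply: quot_le => a v b w e.
by apply: val_inj.
Qed.

End FsetDecomposition.

(** * The two instances *)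

Section Instances.
Variable R : realType.
Implicit Types (S C : {fset R[i]}).

(** The curves are the lines a x + alpha = (alpha + u) y; two points determine
    the line because alpha is not 0.  For u = - alpha the second quotient is not
    defined. *)
Lemma decompose_ratios S (alpha : R[i]) (kappa M : R) :
  0 \notin S -> - alpha \notin S -> alpha != 0 -> 0 < M -> 0 <= kappa ->
  (256 ^ 2 * (160 * 34) ^ 2 * (trunc_log 2 #|` S|).+1 ^ 6 * #|` S| ^ 7)%N%:R <= (kappa * M) ^+ 2 ->
  exists B C, [/\ is_partition2 S B C,
     (quotient_energy (fun a z => z / a) B)%:R <= M
   & (quotient_energy (fun u z => (alpha + z) / (alpha + u)) C)%:R <= kappa * #|` S|%:R ^+ 2].
Proof.
move=> S0 Sa a0; have nz v : v \in S -> v != 0 by move=> vS; apply: contraNneq S0 => <-.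
have nza v : v \in S -> alpha + v != 0.
  by move=> vS; apply: contraNneq Sa => /eqP; rewrite addrC addr_eq0 => /eqP <-.
apply: decompose_fset => //.
- move=> a aS; apply: (@disc_map_affine _ _ a^-1 0); first by rewrite invr_eq0 nz.
  by move=> z; rewrite addr0 mulrC.
- move=> u uS; apply: (@disc_map_affine _ _ (alpha + u)^-1 (alpha / (alpha + u))).
    by rewrite invr_eq0 nza.
  by move=> z; rewrite mulrDl addrC [z / _]mulrC.
- move=> a aS v v' _ _ /mulIf; apply; by rewrite invr_eq0 nz.
- by move=> v vS a a' _ _ /(mulfI (nz v vS)) /invr_inj.
- move=> u uS v v' _ _ /mulIf e; apply: (@addrI _ alpha); apply: e.
  by rewrite invr_eq0 nza.
- by move=> v vS u u' _ _ /(mulfI (nza v vS)) /invr_inj /addrI.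
move=> x x' y y' nx ny; pose w := alpha * (y - y') / (y' - x' * y / x).
exists w, w => a u v v' aS uS vS vS' ex ex' ey ey'; left.
have x0 : x != 0 by rewrite -ex mulf_neq0 ?invr_eq0 ?nz.
have e1 : v * (y' - x' * y / x) = alpha * (y - y').
  rewrite -ex -ex' -ey -ey'; have := nz _ aS; have := nza _ uS; have := nz _ vS.
  move=> h1 h2 h3; field; by rewrite h1 h2 h3.
have d0 : y' - x' * y / x != 0.
  apply: contra_eq_neq e1 => ->; rewrite mulr0 eq_sym mulf_neq0 // subr_eq0 //.
by rewrite /w -e1 mulfK.
Qed.

(** The curves are the hyperbolas (x + a) (y + 1/u) = 1.  Two of their points
    determine v - v' and 1/v - 1/v', hence a quadratic equation for v. *)
Lemma decompose_differences S (kappa M : R) :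
  0 \notin S -> 0 < M -> 0 <= kappa ->
  (256 ^ 2 * (160 * 34) ^ 2 * (trunc_log 2 #|` S|).+1 ^ 6 * #|` S| ^ 7)%N%:R <= (kappa * M) ^+ 2 ->
  exists B C, [/\ is_partition2 S B C,
     (quotient_energy (fun a z => z - a) B)%:R <= M
   & (quotient_energy (fun u z => z^-1 - u^-1) C)%:R <= kappa * #|` S|%:R ^+ 2].
Proof.
move=> S0; have nz v : v \in S -> v != 0 by move=> vS; apply: contraNneq S0 => <-.
apply: decompose_fset => //.
- move=> a aS; apply: (@disc_map_affine _ _ 1 (- a)); first exact: oner_neq0.
  by move=> z; rewrite mul1r.
- by move=> u uS; apply: (@disc_map_inversion _ _ (- u^-1)).
- by move=> a aS v v' _ _ /addIr.
- by move=> v vS a a' _ _ /addrI /oppr_inj.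
- by move=> u uS v v' _ _ /addIr /invr_inj.
- by move=> v vS u u' _ _ /addrI /oppr_inj /invr_inj.
move=> x x' y y' nx ny; pose s := sqrtc ((x - x') ^+ 2 - 4 * (x - x') / (y - y')).
exists ((x - x' + s) / 2), ((x - x' - s) / 2) => a u v v' aS uS vS vS' ex ex' ey ey'.
have dx : v - v' = x - x' by rewrite -ex -ex'; ring.
have dy : v^-1 - v'^-1 = y - y' by rewrite -ey -ey'; ring.
have : (2 * v - (x - x')) ^+ 2 = s ^+ 2.
  rewrite sqr_sqrtc -dx -dy; have h1 := nz _ vS; have h2 := nz _ vS'.
  have h3 : v' - v != 0.
    by rewrite subr_eq0; apply: contra_neq nx => e; rewrite -ex -ex' e.
  by field; rewrite h1 h2 mulN1r h3.
move/eqP; rewrite eqf_sqr => /orP[] /eqP e; [left|right].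
  by rewrite -e; field.
by rewrite -[s]opprK -e; field.
Qed.

(** A quadruple with an entry equal to p is determined by two other entries. *)
Lemma mul_energy_remove (K : fieldType) (B : {fset K}) (p : K) : 0 \notin B ->
  (mul_energy B <= quotient_energy (fun a z => (z / a)%R) (B `\ p)%fset + 4 * #|` B| ^ 2)%N.
Proof.
move=> B0; have nz (v : B) : val v != 0 by apply: contraNneq B0 => <-; exact: valP.
set Q := [set q : B * B * B * B | let: (x1, x2, x3, x4) := q in val x1 * val x3 == val x2 * val x4].
pose Q0 := [set q : B * B * B * B | let: (x1, x2, x3, x4) := q in
  [&& val x1 * val x3 == val x2 * val x4, val x1 != p, val x2 != p, val x3 != p & val x4 != p]].
pose Q1 := [set q in Q | val q.1.1.1 == p].
pose Q2 := [set q in Q | val q.1.1.2 == p].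
pose Q3 := [set q in Q | val q.1.2 == p].
pose Q4 := [set q in Q | val q.2 == p].
have QE : Q \subset Q0 :|: (Q1 :|: Q2 :|: (Q3 :|: Q4)).
  apply/subsetP=> -[[[x1 x2] x3] x4]; rewrite !inE /= => ->.
  by case: (_ == p); case: (_ == p); case: (_ == p); case: (_ == p).
have le_sq (q : {set B * B * B * B}) (F : B * B * B * B -> B * B) :
    {in q &, injective F} -> (#|q| <= #|` B| ^ 2)%N.
  move=> Finj; rewrite -(card_in_imset Finj) -mulnn cardfE -card_prod; exact: max_card.
have h1 : (#|Q1| <= #|` B| ^ 2)%N.
  apply: (le_sq _ (fun q => (q.1.1.2, q.2))) => -[[[x1 x2] x3] x4] [[[y1 y2] y3] y4].
  rewrite !inE /= => /andP[/eqP e /eqP ep] /andP[/eqP f /eqP fp] [e2 e4]; subst y2 y4.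
  have e1 : x1 = y1 by apply: val_inj; rewrite /= ep fp.
  subst y1; congr (_, _, _, _); apply: val_inj; apply: (mulfI (nz x1)); by rewrite /= e f.
have h2 : (#|Q2| <= #|` B| ^ 2)%N.
  apply: (le_sq _ (fun q => (q.1.1.1, q.1.2))) => -[[[x1 x2] x3] x4] [[[y1 y2] y3] y4].
  rewrite !inE /= => /andP[/eqP e /eqP ep] /andP[/eqP f /eqP fp] [e2 e4]; subst y1 y3.
  have e1 : x2 = y2 by apply: val_inj; rewrite /= ep fp.
  subst y2; congr (_, _, _, _); apply: val_inj; apply: (mulfI (nz x2)); by rewrite /= -e -f.
have h3 : (#|Q3| <= #|` B| ^ 2)%N.
  apply: (le_sq _ (fun q => (q.1.1.2, q.2))) => -[[[x1 x2] x3] x4] [[[y1 y2] y3] y4].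
  rewrite !inE /= => /andP[/eqP e /eqP ep] /andP[/eqP f /eqP fp] [e2 e4]; subst y2 y4.
  have e1 : x3 = y3 by apply: val_inj; rewrite /= ep fp.
  subst y3; congr (_, _, _, _); apply: val_inj; apply: (mulIf (nz x3)); by rewrite /= e f.
have h4 : (#|Q4| <= #|` B| ^ 2)%N.
  apply: (le_sq _ (fun q => (q.1.1.1, q.1.2))) => -[[[x1 x2] x3] x4] [[[y1 y2] y3] y4].
  rewrite !inE /= => /andP[/eqP e /eqP ep] /andP[/eqP f /eqP fp] [e2 e4]; subst y1 y3.
  have e1 : x4 = y4 by apply: val_inj; rewrite /= ep fp.
  subst y4; congr (_, _, _, _); apply: val_inj; apply: (mulIf (nz x4)); by rewrite /= -e -f.
have h0 : (#|Q0| <= quotient_energy (fun a z => z / a)%R (B `\ p)%fset)%N.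
  apply: (@card_quadruples_le _ _ K val val [set y : B | val y != p]).
  - by move=> x y _ _; exact: val_inj.
  - move=> y; rewrite inE => yp.
    have yB : val y \in (B `\ p)%fset by rewrite !inE yp; exact: valP.
    by exists [` yB]%fset.
  - by move=> x1 x2 x3 x4; rewrite !inE => /and5P[_ -> -> -> ->].
  move=> x1 x2 x3 x4 t1 t2 t3 t4 /and5P[/eqP e _ _ _ _] -> -> -> ->.
  by rewrite eqr_div ?nz // e mulrC.
apply: leq_trans (subset_leq_card QE) _.
have [c1 _] := leq_card_setU Q0 (Q1 :|: Q2 :|: (Q3 :|: Q4)).
have [c2 _] := leq_card_setU (Q1 :|: Q2) (Q3 :|: Q4).
have [c3 _] := leq_card_setU Q1 Q2; have [c4 _] := leq_card_setU Q3 Q4.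
move: QE; clear -h0 h1 h2 h3 h4 c1 c2 c3 c4; lia.
Qed.

Lemma mul_energy_translate C (alpha : R[i]) : - alpha \notin C ->
  (mul_energy (fset_translate alpha C) <=
     quotient_energy (fun u z => (alpha + z) / (alpha + u))%R C)%N.
Proof.
move=> Ca; apply: (@card_quadruples_le _ _ R[i] val (fun c => alpha + val c) setT).
- by move=> x y _ _; exact: val_inj.
- by move=> y _; have /imfsetP[z /= zC yz] := valP y; exists [` zC]%fset.
- by move=> *; rewrite !inE.
move=> x1 x2 x3 x4 t1 t2 t3 t4 /eqP e e1 e2 e3 e4.
have nz (t : C) : alpha + val t != 0.
  by apply: contraNneq Ca => /eqP; rewrite addrC addr_eq0 => /eqP <-; exact: valP.
by rewrite eqr_div ?nz // e1 e2 e3 e4 e mulrC.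
Qed.

Lemma eq_subr_add (K : fieldType) (a b c d : K) :
  (a - b == d - c) = (a + c == b + d).
Proof.
rewrite -subr_eq0 -[RHS]subr_eq0; congr (_ == 0); ring.
Qed.

Lemma add_energy_difference (K : fieldType) (B : {fset K}) :
  add_energy B = quotient_energy (fun a z => z - a)%R B.
Proof.
by apply: eq_card => -[[[x1 x2] x3] x4]; rewrite !inE eq_subr_add.
Qed.

Lemma add_energy_inverse C :
  (add_energy (fset_inverse C) <= quotient_energy (fun u z => z^-1 - u^-1)%R C)%N.
Proof.
apply: (@card_quadruples_le _ _ R[i] val (fun c => (val c)^-1) setT).
- by move=> x y _ _; exact: val_inj.
- by move=> y _; have /imfsetP[z /= zC yz] := valP y; exists [` zC]%fset.
- by move=> *; rewrite !inE.
move=> x1 x2 x3 x4 t1 t2 t3 t4 e e1 e2 e3 e4.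
by rewrite eq_subr_add e1 e2 e3 e4.
Qed.

End Instances.

(** * Choice of the threshold *)

Section Threshold.
Variable R : realType.

Lemma one_le_log2 n : (1 < n)%N -> 1 <= log2 (n%:R : R).
Proof.
move=> n1; rewrite /log2 ler_pdivlMr ?ln_gt0 ?ltr1n // mul1r.
by rewrite ler_ln ?posrE ?ltr0n ?ler_nat // ltnW.
Qed.

Lemma trunc_log_le_log2 n : (1 < n)%N -> (trunc_log 2 n).+1%:R <= 2 * log2 (n%:R : R).
Proof.
move=> n1; have n0 : (0 < n)%N by exact: ltnW.
have h1 := one_le_log2 n1.
have : (trunc_log 2 n)%:R <= log2 (n%:R : R).
  rewrite /log2 ler_pdivlMr ?ln_gt0 ?ltr1n // mulr_natl -lnXn ?ltr0n //.
  rewrite ler_ln ?posrE ?exprn_gt0 ?ltr0n // -natrX ler_nat.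
  by have /andP[] := trunc_log_bounds (isT : (1 < 2)%N) n0.
rewrite -natr1; lra.
Qed.

(** At most three logarithms are lost; the exponent of the logarithm in the
    implied bound is at least 5. *)
Lemma lesssim_of_le n (E : nat) (K0 w : R) : 0 <= K0 -> (1 < n)%N -> w = n%:R `^ (1 / 4) ->
  E%:R <= (256 * K0 * (trunc_log 2 n).+1%:R ^+ 3 + 5) * w ^+ 11 ->
  lesssim (256 * K0 * 8 + 5) n E%:R (n%:R `^ (3 - 1 / 4)).
Proof.
move=> K00 n1 wE hE; set C0 := _ + 5; rewrite /lesssim.
have -> : (n%:R : R) `^ (3 - 1 / 4) = w ^+ 11.
  rewrite wE -powR_mulrn ?powR_ge0 // -powRrM; congr (_ `^ _); lra.
have w0 : 0 <= w by rewrite wE powR_ge0.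
apply: (le_trans hE); apply: ler_wpM2r; first exact: exprn_ge0.
have lg1 := one_le_log2 n1; have tl := trunc_log_le_log2 n1.
set lg := log2 _ in lg1 tl *; set l : R := (trunc_log 2 n).+1%:R in tl *.
have l3 : l ^+ 3 <= 8 * lg ^+ 3.
  have -> : 8 * lg ^+ 3 = (2 * lg) ^+ 3 by ring.
  by rewrite lerXn2r ?nnegrE ?ler0n //; lra.
have lg3 : 1 <= lg ^+ 3 by rewrite exprn_ege1.
have lgC : lg ^+ 3 <= lg `^ C0.
  rewrite -powR_mulrn; last lra.
  by apply: ler_powR => //; rewrite /C0; lra.
apply: (@le_trans _ _ (C0 * lg ^+ 3)).
  have := ler_wpM2l K00 l3; rewrite /C0; move: (K0) (l ^+ 3) (lg ^+ 3) lg3 => k a b b1; nra.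
by apply: ler_wpM2l => //; rewrite /C0; lra.
Qed.

(** With w = n^(1/4) the threshold is w^11 = n^(11/4). *)
Lemma threshold_bound (k m n : nat) (w : R) : (m <= n)%N -> w ^+ 4 = n%:R ->
  (256 ^ 2 * k ^ 2 * (trunc_log 2 m).+1 ^ 6 * m ^ 7)%N%:R
    <= (256 * k%:R * (trunc_log 2 n).+1%:R ^+ 3 * w ^+ 3 * w ^+ 11) ^+ 2.
Proof.
move=> mn w4; set l := (trunc_log 2 n).+1.
have -> : (256 * k%:R * l%:R ^+ 3 * w ^+ 3 * w ^+ 11) ^+ 2
    = (256 ^ 2 * k ^ 2 * l ^ 6 * n ^ 7)%N%:R.
  rewrite natrM [(n ^ 7)%:R]natrX natrM [(l ^ 6)%:R]natrX natrM [(k ^ 2)%:R]natrX -w4 natrX; ring.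
rewrite ler_nat leq_mul ?leq_exp2r // leq_mul // leq_exp2r // ltnS.
exact: leq_trunc_log.
Qed.

End Threshold.

Theorem theorem9 (R : realType) :
  let delta : R := 1 / 4 in
  exists C0 : R, 0 < C0 /\
    forall (A : {fset R[i]}) (alpha : R[i]),
      0 \notin A -> (1 < #|` A|)%N -> alpha != 0 ->
      (exists B C : {fset R[i]},
        is_partition2 A B C /\
        lesssim C0 #|` A|
          (maxn (mul_energy B) (mul_energy (fset_translate alpha C)))%:R
          ((#|` A|%:R : R) `^ (3 - delta))) /\
      (exists B' C' : {fset R[i]},
        is_partition2 A B' C' /\
        lesssim C0 #|` A|
          (maxn (add_energy B') (add_energy (fset_inverse C')))%:R
          ((#|` A|%:R : R) `^ (3 - delta))).
Proof.
move=> delta; pose K0 : R := (160 * 34)%N%:R.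
have K00 : 0 <= K0 by exact: ler0n.
exists (256 * K0 * 8 + 5); split; first lra.
move=> A alpha A0 A1 alpha0; set n := #|` A|.
pose w : R := n%:R `^ (1 / 4); pose l : R := (trunc_log 2 n).+1%:R.
have w4 : w ^+ 4 = n%:R.
  by rewrite -powR_mulrn ?powR_ge0 // -powRrM (_ : 1 / 4 * 4%:R = 1) ?powRr1 ?ler0n //; lra.
have w1 : 1 <= w.
  have : (1 : R) `^ (1 / 4) <= w.
    by apply: ge0_ler_powR; rewrite ?nnegrE ?ler0n ?ler1n ?(ltnW A1) //; lra.
  by rewrite powR1.
have w0 : 0 < w by lra.
pose kappa := 256 * K0 * l ^+ 3 * w ^+ 3.
have kappa0 : 0 <= kappa by rewrite !mulr_ge0 ?exprn_ge0 ?ler0n // ltW.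
have M0 : 0 < w ^+ 11 by exact: exprn_gt0.
(* Both M = w^11 and kappa n^2 are n^(11/4), up to logarithms. *)
have kappa_n : kappa * n%:R ^+ 2 = 256 * K0 * l ^+ 3 * w ^+ 11.
  by rewrite -w4 /kappa; ring.
have le_max (E1 E2 : nat) : E1%:R <= 5 * w ^+ 11 -> E2%:R <= kappa * n%:R ^+ 2 ->
    lesssim (256 * K0 * 8 + 5) n (maxn E1 E2)%:R ((n%:R : R) `^ (3 - delta)).
  have big0 : 0 <= 256 * K0 * l ^+ 3 * w ^+ 11.
    by rewrite -kappa_n mulr_ge0 // exprn_ge0.
  rewrite kappa_n => h1 h2; apply: (@lesssim_of_le _ _ _ K0 w) => //.
  rewrite -/l -/K0 mulrDl natr_max ge_max; apply/andP; split; lra.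
split.
  pose S := (A `\ (- alpha))%fset.
  have SA : (S `<=` A)%fset by exact: fsubD1set.
  have leS : (#|` S| <= n)%N by exact: fsubset_leq_card.
  have S0 : 0 \notin S by apply: contra A0; apply: (fsubsetP SA).
  have Sa : - alpha \notin S by rewrite !inE eqxx.
  have [B [C [[SBC dBC] EB EC]]] := decompose_ratios S0 Sa alpha0 M0 kappa0 (threshold_bound (160 * 34) leS w4).
  have CS : (C `<=` S)%fset by rewrite SBC fsubsetUr.
  (* If - alpha lies in A, it is put into B, at the cost of O(n^2). *)
  exists (A `\` C)%fset, C; split.
    split; last by apply/fdisjointP=> z; rewrite inE => /andP[].
    apply/fsetP=> z; rewrite !inE; have [zC|] := boolP (z \in C); last by rewrite orbF.
    by rewrite (fsubsetP SA) // (fsubsetP CS).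
  apply: le_max.
    have A0' : 0 \notin (A `\` C)%fset by rewrite inE negb_and A0 orbT.
    have h := mul_energy_remove (- alpha) A0'.
    have BE : ((A `\` C) `\ (- alpha))%fset = B.
      apply/fsetP=> z; have := congr1 (fun X : {fset R[i]} => z \in X) SBC.
      rewrite !inE => zS; rewrite andbCA zS.
      have [zC|] := boolP (z \in C); last by rewrite orbF.
      by apply/esym/negbTE/negP=> zB; have := fdisjointP dBC z zB; rewrite zC.
    rewrite BE in h; apply: (@le_trans _ _ (w ^+ 11 + 4 * n%:R ^+ 2)).
      apply: (@le_trans _ _ (quotient_energy (fun a z => z / a) B + 4 * n ^ 2)%N%:R).
        rewrite ler_nat; apply: leq_trans h _; rewrite leq_add2l leq_mul2l leq_exp2r //.
        by rewrite fsubset_leq_card ?orbT // fsubsetDl.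
      by rewrite natrD natrM natrX lerD2r.
    have : n%:R ^+ 2 <= w ^+ 11 by rewrite -w4 -exprM; apply: ler_weXn2l.
    lra.
  apply: le_trans (_ : kappa * #|` S|%:R ^+ 2 <= _); last first.
    by rewrite ler_wpM2l // ler_sqr ?nnegrE // ler_nat.
  apply: le_trans EC; rewrite ler_nat; apply: mul_energy_translate.
  by apply: contra Sa; apply: (fsubsetP CS).
have [B [C [part EB EC]]] := decompose_differences A0 M0 kappa0 (threshold_bound (160 * 34) (leqnn n) w4).
exists B, C; split=> //; apply: le_max; first by rewrite add_energy_difference; lra.
by apply: le_trans EC; rewrite ler_nat; exact: add_energy_inverse.
Qed.
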